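(* If $\frac{4}{3}\le q\le\infty$, then $\mathfrak{p}_2(q)\le \mathfrak{a}_2(q)$, where $\mathfrak{a}_2(q)=2+\frac{2}{2+\frac{2}{q-2}} = 4-\frac{q}{q-1}$ (interpreted as $2$ at $q=2$ and as $3$ at $q=\infty$). If $1\le q<\frac{4}{3}$, then $\mathfrak{p}_2(q)=-1$.
   Context: $\mathbb{T}^d$ is the $d$-fold torus with normalized Haar measure. Every $\psi\in L^q(\mathbb{T}^d)$, $q\ge1$, has Fourier series $\sum_{\alpha\in\mathbb{Z}^d}\widehat\psi(\alpha)z^\alpha$; $H^p(\mathbb{T}^d)$ for $p\ge1$ consists of $\psi\in L^p(\mathbb{T}^d)$ with $\widehat\psi(\alpha)=0$ for $\alpha\notin\mathbb{N}_0^d$, and for $0<p<1$ it is the usual Hardy space on the polydisc identified with boundary values. The Riesz projection is $P_+\psi=\sum_{\alpha\in\mathbb{N}_0^d}\widehat\psi(\alpha)z^\alpha$ (it maps $L^1(\mathbb{T}^d)$ into $H^p(\mathbb{T}^d)$ for all $0<p<1$). For nontrivial $\varphi$ in some $H^p(\mathbb{T}^d)$, $\|\varphi\|_0:=\exp\left(\int_{\mathbb{T}^d}\log|\varphi|\right)$. For $1\le q\le\infty$, $\mathfrak{p}_d(q):=\sup\{p\ge0: \|P_+\psi\|_p\le\|\psi\|_q \text{ for every }\psi\in L^q(\mathbb{T}^d)\}$ if this set is nonempty, and $\mathfrak{p}_d(q):=-1$ otherwise. *)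

(* Defs.v *)
From mathcomp Require Import all_boot all_order all_algebra.
From mathcomp Require Import all_classical all_reals all_analysis.
From mathcomp Require Import complex.

Set Implicit Arguments.
Unset Strict Implicit.
Unset Printing Implicit Defensive.

Import Order.TTheory GRing.Theory Num.Theory.
Import numFieldNormedType.Exports.

Local Open Scope classical_set_scope.
Local Open Scope ring_scope.

Section Torus.
Variable R : realType.

(* The 2-torus T^2, parametrized by t = (t1,t2) in [0,1]^2 via
   (z1,z2) = (e^{2 pi i t1}, e^{2 pi i t2}); normalized Haar measure
   corresponds to Lebesgue measure on [0,1]^2. *)
Definition torus : set (R * R) := `[0%R, 1%R] `*` `[0%R, 1%R].

Lemma measurable_torus : measurable torus.
Proof.
apply: measurableX; exact: measurable_itv.
Qed.

Definition leb2 := ((@lebesgue_measure R) \x (@lebesgue_measure R))%E.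

Definition haar2 := mrestr leb2 measurable_torus.

Definition expi (th : R) : R[i] :=
  (cos (2 * pi * th) +i* sin (2 * pi * th))%C.

Definition cabs (z : R[i]) : R := Num.sqrt (complex.Re z ^+ 2 + complex.Im z ^+ 2).

Definition cint (f : R * R -> R[i]) : R[i] :=
  (Rintegral haar2 setT (fun t => complex.Re (f t)) +i*
   Rintegral haar2 setT (fun t => complex.Im (f t)))%C.

Definition Lqnorm (q : \bar R) (psi : R * R -> R[i]) : \bar R :=
  Lnorm haar2 q (fun t => (cabs (psi t))%:E).

Definition inLq (q : \bar R) (psi : R * R -> R[i]) : Prop :=
  [/\ measurable_fun torus (fun t => complex.Re (psi t)),
      measurable_fun torus (fun t => complex.Im (psi t)) &
      (Lqnorm q psi < +oo)%E].

Definition fourier (psi : R * R -> R[i]) (a b : int) : R[i] :=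
  cint (fun t => psi t * expi (- (a%:~R * t.1 + b%:~R * t.2))).

(* The Riesz projection P_+ psi as a holomorphic function on the bidisc:
   sum_{a,b >= 0} psi^(a,b) z1^a z2^b (limit of square partial sums). *)
Definition riesz_partial (psi : R * R -> R[i]) (z1 z2 : R[i]) (N : nat) : R[i] :=
  \sum_(a < N) \sum_(b < N) fourier psi a%:Z b%:Z * z1 ^+ a * z2 ^+ b.

Definition riesz_hol (psi : R * R -> R[i]) (z1 z2 : R[i]) : R[i] :=
  (lim ((fun N => complex.Re (riesz_partial psi z1 z2 N)) @ \oo) +i*
   lim ((fun N => complex.Im (riesz_partial psi z1 z2 N)) @ \oo))%C.

(* Boundary values (radial limits) of P_+ psi on T^2; this is the element of
   H^p(T^2) identified with its boundary function. *)
Definition riesz (psi : R * R -> R[i]) (t : R * R) : R[i] :=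
  let g r := riesz_hol psi ((r%:C)%C * expi t.1) ((r%:C)%C * expi t.2) in
  (lim ((fun r => complex.Re (g r)) @ at_left 1) +i*
   lim ((fun r => complex.Im (g r)) @ at_left 1))%C.

Definition elog (x : R) : \bar R := if x == 0 then -oo%E else (ln x)%:E.

Definition Hnorm (p : R) (phi : R * R -> R[i]) : \bar R :=
  if p == 0 then expeR (\int[haar2]_t elog (cabs (phi t)))%E
  else Lnorm haar2 p%:E (fun t => (cabs (phi t))%:E).

Definition admissible (q : \bar R) (p : R) : Prop :=
  0 <= p /\
  forall psi, inLq q psi -> (Hnorm p (riesz psi) <= Lqnorm q psi)%E.

Definition pfrak2 (q : \bar R) : \bar R :=
  if `[< exists p, admissible q p >]
  then ereal_sup [set p%:E | p in admissible q]
  else (-1)%E.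

Definition afrak2 (q : \bar R) : \bar R :=
  match q with
  | r%:E => (4 - r / (r - 1))%:E
  | +oo%E => 3%:E
  | -oo%E => 0%E
  end.

End Torus.

(* Main.v *)
(* Let [w = (z1 z2)^2], [u = z1 / z2 + z2 / z1 = 2 cos(2 pi (t1 - t2))] and let
   [b = (w - a) / (1 - a w)], [0 < a < 1].  The map [P_+] fixes functions of [w]
   that are analytic, while [P_+ (u Q(w)) = u (Q(w) - Q(0))].  Hence for
   [psi = b (1 + e u (b + y / b))] one gets
   [P_+ psi = b (1 + e u (b - a^2 / b))].  Since [|b| = 1], both [|psi|] and
   [|P_+ psi|] are perturbations of [1]; [u] has mean [0], so the logarithms of
   their norms are of order [e^2] with explicit coefficients.  Comparing these
   coefficients for the optimal [y], and then letting [a] tend to [1], yields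
   [p (q - 1) <= 3 q - 4].  For [q = oo] one takes [y = -1] and adds
   a term of order [e^2] making [|psi| = 1 + O(e^3)]; this gives [p <= 3].
   Everything is done with Taylor polynomials of [b] in place of [b], so that
   only trigonometric polynomials occur. *)

Require Import Defs.
From mathcomp Require Import all_boot all_order all_algebra.
From mathcomp Require Import all_classical all_reals all_analysis.
From mathcomp Require Import measurable_realfun ess_sup_inf complex ring lra.

Set Implicit Arguments.
Unset Strict Implicit.
Unset Printing Implicit Defensive.

Import Order.TTheory GRing.Theory Num.Theory.
Import numFieldNormedType.Exports.

Local Open Scope classical_set_scope.
Local Open Scope ring_scope.
Local Open Scope complex_scope.

(** * Integration over the torus *)

Lemma cos_periodic_int (R : realType) (x : R) (m : int) :
  cos (x + 2 * pi * m%:~R) = cos x.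
Proof.
have P n (y : R) : cos (y + 2 * pi * n%:R) = cos y.
  by rewrite mulr_natl mulr_natr (periodicn (@cosD2pi R)).
case: m => n; first by rewrite -pmulrn P.
by rewrite NegzE mulrNz mulrN -pmulrn -[LHS](P n.+1) subrK.
Qed.

Lemma sin_periodic_int (R : realType) (x : R) (m : int) :
  sin (x + 2 * pi * m%:~R) = sin x.
Proof. by rewrite -!cosBpihalf addrAC cos_periodic_int. Qed.

Section HaarIntegral.
Variable R : realType.
Local Notation haar := (@haar2 R).

(** The phase [c] treats cosine and sine at once: [c = 0] gives the real part of a wave,
    [c = - pi / 2] its imaginary part. For [m != 0] the antiderivative has period 1. *)
Lemma integral_cos1 (m : int) (c : R) :
  (\int[lebesgue_measure]_(x in `[0%R, 1%R])
     (cos (2 * pi * (m%:~R * x) + c))%:E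
   = (if m == 0 then cos c else 0)%:E)%E.
Proof.
have [->|m0] := eqVneq m 0.
  rewrite (eq_integral (cst (cos c)%:E)); last first.
    by move=> x _ /=; rewrite mul0r mulr0 add0r.
  rewrite integral_cst//= lebesgue_measure_itv/= lte_fin ltr01 oppr0 adde0.
  by rewrite mule1.
have k0 : 2 * pi * m%:~R != 0 :> R.
  by rewrite mulf_neq0// ?intr_eq0// mulf_neq0// gt_eqF// pi_gt0.
pose F (x : R) := sin (2 * pi * (m%:~R * x) + c) * (2 * pi * m%:~R)^-1.
have dF (x : R) : is_derive x (1 : R) F (cos (2 * pi * (m%:~R * x) + c)).
  rewrite /F; apply: is_derive_eq.
  rewrite !scaler0 add0r !addr0 /GRing.scale /=.
  by move: k0; set w := 2 * pi; rewrite mulf_eq0 negb_or => /andP[? ?]; field; apply/andP.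
have cF : continuous F.
  move=> x; apply: differentiable_continuous; apply/derivable1_diffP.
  by case: (dF x).
rewrite (@continuous_FTC2 _ _ F)//.
- rewrite /F !mulr1 mulr0 mulr0 add0r [_ + c]addrC sin_periodic_int.
  by rewrite -EFinB subrr.
- apply: continuous_subspaceT => x.
  apply: continuous_comp; last exact: continuous_cos.
  by apply: cvgD; [|exact: cvg_cst]; apply: cvgMr; apply: cvgMr; exact: cvg_id.
- split.
  + by move=> x _; case: (dF x).
  + by apply: cvg_at_right_filter; exact: cF.
  + by apply: cvg_at_left_filter; exact: cF.
- move=> x _; rewrite derive1E; exact: derive_val.
Qed.

Lemma haar2_setT : haar setT = 1%:E.
Proof.
rewrite /haar2 /mrestr setTI /leb2 /torus.
have -> : ((@lebesgue_measure R) \x (@lebesgue_measure R))%E (`[0%R, 1%R] `*` `[0%R, 1%R])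
  = (lebesgue_measure (`[0%R, 1%R]%classic : set R) * lebesgue_measure (`[0%R, 1%R]%classic : set R))%E.
  by apply: product_measure1E; exact: measurable_itv.
by rewrite lebesgue_measure_itv/= lte_fin ltr01 oppr0 adde0 mule1.
Qed.

Lemma haar2_lty : (haar setT < +oo)%E.
Proof. by rewrite haar2_setT ltry. Qed.

Lemma haar2_integrable (f : R * R -> R) (M : R) :
  measurable_fun setT f -> (forall t, `|f t| <= M) ->
  haar.-integrable setT (EFin \o f).
Proof.
move=> mf bf; apply: measurable_bounded_integrable => //.
  exact: haar2_lty.
exists M; split; first exact: num_real.
by move=> x /ltW Mx t _; exact: le_trans (bf t) Mx.
Qed.

Lemma measurable_torus_wave (m n : int) (c : R) :
  measurable_fun setT
    (fun t : R * R => cos (2 * pi * (m%:~R * t.1 + n%:~R * t.2) + c)).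
Proof.
apply: (@measurableT_comp _ _ _ _ _ _ (@cos R)).
  by apply: continuous_measurable_fun; exact: continuous_cos.
apply: measurable_funD => //; apply: measurable_funM => //.
by apply: measurable_funD; apply: measurable_funM.
Qed.

(** [haar2] lives on the whole plane but gives no mass to the complement of the square; discarding
    that null set leads to a product measure, to which Fubini applies. *)
Lemma integral_haar2 (f : R * R -> R) (M : R) :
  measurable_fun setT f -> (forall t, `|f t| <= M) ->
  (\int[haar]_t (f t)%:E = \int[@leb2 R]_(t in @torus R) (f t)%:E)%E.
Proof.
move=> mf bf; have mT := @measurable_torus R.
have mTC := measurableC mT.
have T0 : haar (~` @torus R) = 0 by rewrite /haar2 /mrestr setICl; exact: (@measure0 _ _ _ (@leb2 R)).
have E := @negligible_integral _ _ _ haar setT (~` @torus R) (EFin \o f)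
  mTC measurableT (haar2_integrable mf bf) T0.
transitivity (\int[haar]_(t in setT `\` ~` @torus R) (f t)%:E)%E.
  exact: E.
rewrite setDE setCK setTI; apply: eq_measure_integral => A mA AT.
exact: (congr1 (@leb2 R) (setIidl AT)).
Qed.

Lemma Rintegral_wave (m n : int) (c : R) :
  Rintegral haar setT
    (fun t => cos (2 * pi * (m%:~R * t.1 + n%:~R * t.2) + c))
  = if (m == 0) && (n == 0) then cos c else 0.
Proof.
have mf := measurable_torus_wave m n c.
have bf (t : R * R) :
    `|cos (2 * pi * (m%:~R * t.1 + n%:~R * t.2) + c)| <= 1.
  by rewrite ler_norml cos_geN1 cos_le1.
rewrite /Rintegral (integral_haar2 mf bf) integral_mkcond.
rewrite -integral12_prod_meas1/=; last first.
  apply/integrable_restrict => //; first exact: (@measurable_torus R).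
  rewrite setTI; apply: measurable_bounded_integrable.
  - exact: (@measurable_torus R).
  - have := haar2_lty; rewrite /haar2 /mrestr setTI; exact.
  - exact: measurable_funTS.
  - by exists 1; split; [exact: num_real|move=> x /ltW x1 t _; exact: le_trans (bf t) x1].
(* For the inner integral over [y], the quantity [2 pi m x + c] is just a phase. *)
have -> : (\int[lebesgue_measure]_(x in setT) \int[lebesgue_measure]_(y in setT)
   ((fun t : R * R => (cos (2 * pi * (m%:~R * t.1 + n%:~R * t.2) + c))%:E) \_ (@torus R)) (x, y)
  = \int[lebesgue_measure]_(x in `[0%R, 1%R])
     (if n == 0 then cos (2 * pi * (m%:~R * x) + c) else 0)%:E)%E.
  rewrite [RHS]integral_mkcond; apply: eq_integral => x _.
  rewrite [RHS]patchE; case: ifPn => xI.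
    transitivity (\int[lebesgue_measure]_(y in `[0%R, 1%R])
        (cos (2 * pi * (n%:~R * y) + (2 * pi * (m%:~R * x) + c)))%:E)%E.
      rewrite [RHS]integral_mkcond; apply: eq_integral => y _.
      rewrite !patchE; have -> : ((x, y) \in @torus R) = (y \in `[0%R, 1%R]%classic).
        by apply/idP/idP; rewrite !inE /torus /=; [case|split => //; move: xI; rewrite inE].
      by case: ifP => // _; congr (cos _)%:E => /=; ring.
    by rewrite integral_cos1.
  apply: integral0_eq => y _; rewrite patchE ifF//.
  by apply/negP; rewrite inE /torus => -[/=]; move: xI; rewrite notin_setE.
case: (n == 0); rewrite ?andbT ?andbF; first by rewrite integral_cos1.
by rewrite integral0.
Qed.

End HaarIntegral.

(** * The Riesz projection of a trigonometric polynomial *)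

Section TrigonometricPolynomials.
Variable R : realType.
Local Notation haar := (@haar2 R).
Implicit Types (s : seq (R * (int * int))) (t : R * R).

Definition wave (m n : int) t : R[i] := expi (m%:~R * t.1 + n%:~R * t.2).

(** With lists, sums are concatenations and the projection is a filter; a frequency may occur
    several times. *)
Definition tpoly s t : R[i] := \sum_(i <- s) (i.1)%:C * wave i.2.1 i.2.2 t.

Lemma expiD (x y : R) : expi (x + y) = expi x * expi y.
Proof.
rewrite /expi mulrDr cosD sinD; simpc; congr (_ +i* _).
by rewrite addrC [X in _ + X]mulrC.
Qed.

Lemma expi0 : expi 0 = 1 :> R[i].
Proof. by rewrite /expi mulr0 cos0 sin0. Qed.

Lemma expiX (x : R) (n : nat) : expi x ^+ n = expi (n%:R * x).
Proof.
elim: n => [|n IH]; first by rewrite mul0r expi0.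
by rewrite exprS IH -expiD -natr1 mulrDl mul1r addrC.
Qed.

Lemma waveM (m n m' n' : int) t : wave m n t * wave m' n' t = wave (m + m') (n + n') t.
Proof. by rewrite /wave -expiD !intrD; congr expi; ring. Qed.

Lemma wave0 t : wave 0 0 t = 1.
Proof. by rewrite /wave !mul0r addr0 expi0. Qed.

Lemma Re_sum (I : Type) (r : seq I) (P : pred I) (F : I -> R[i]) :
  complex.Re (\sum_(i <- r | P i) F i) = \sum_(i <- r | P i) complex.Re (F i).
Proof. exact: (raddf_sum (@complex.Re R)). Qed.

Lemma Im_sum (I : Type) (r : seq I) (P : pred I) (F : I -> R[i]) :
  complex.Im (\sum_(i <- r | P i) F i) = \sum_(i <- r | P i) complex.Im (F i).
Proof. exact: (raddf_sum (@complex.Im R)). Qed.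

Lemma Re_wave (m n : int) t :
  complex.Re (wave m n t) = cos (2 * pi * (m%:~R * t.1 + n%:~R * t.2) + 0).
Proof. by rewrite addr0. Qed.

Lemma Im_wave (m n : int) t :
  complex.Im (wave m n t) = cos (2 * pi * (m%:~R * t.1 + n%:~R * t.2) - pi / 2).
Proof. by rewrite cosBpihalf. Qed.

Lemma Re_realM (x : R) (z : R[i]) : complex.Re (x%:C * z) = x * complex.Re z.
Proof. by case: z => a b /=; rewrite mul0r subr0. Qed.

Lemma Im_realM (x : R) (z : R[i]) : complex.Im (x%:C * z) = x * complex.Im z.
Proof. by case: z => a b /=; rewrite mul0r addr0. Qed.

Definition wsum s (c : R) t : R :=
  \sum_(i <- s) i.1 * cos (2 * pi * (i.2.1%:~R * t.1 + i.2.2%:~R * t.2) + c).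

Lemma Re_tpoly s t : complex.Re (tpoly s t) = wsum s 0 t.
Proof. by rewrite /tpoly Re_sum; apply: eq_bigr => i _; rewrite Re_realM Re_wave. Qed.

Lemma Im_tpoly s t : complex.Im (tpoly s t) = wsum s (- (pi / 2)) t.
Proof. by rewrite /tpoly Im_sum; apply: eq_bigr => i _; rewrite Im_realM Im_wave. Qed.

Lemma measurable_wsum s c : measurable_fun setT (wsum s c).
Proof.
apply: measurable_sum => i; apply: measurable_funM => //.
exact: measurable_torus_wave.
Qed.

Lemma wsum_bound s c : exists M, forall t, `|wsum s c t| <= M.
Proof.
exists (\sum_(i <- s) `|i.1|) => t; apply: (le_trans (ler_norm_sum _ _ _)).
apply: ler_sum => i _; rewrite normrM ler_piMr// ler_norml.
by rewrite cos_geN1 cos_le1.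
Qed.

Lemma wsum_integrable s c : haar.-integrable setT (EFin \o wsum s c).
Proof.
have [M hM] := wsum_bound s c.
exact: (haar2_integrable (@measurable_wsum s c) hM).
Qed.

Lemma Rintegral_wsum s c :
  Rintegral haar setT (wsum s c) =
  cos c * \sum_(i <- s | i.2 == (0, 0)) i.1.
Proof.
elim: s => [|i s IH].
  rewrite big_nil mulr0 /Rintegral.
  by rewrite integral0_eq// => x _; rewrite /wsum big_nil.
pose f t := i.1 * cos (2 * pi * (i.2.1%:~R * t.1 + i.2.2%:~R * t.2) + c).
have -> : wsum (i :: s) c = fun t => f t + wsum s c t.
  by apply/funext => t; rewrite /wsum big_cons.
have i1 : haar.-integrable setT
    (EFin \o (fun t => cos (2 * pi * (i.2.1%:~R * t.1 + i.2.2%:~R * t.2) + c))).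
  apply: (@haar2_integrable _ _ 1); first exact: measurable_torus_wave.
  by move=> t; rewrite ler_norml cos_geN1 cos_le1.
have fi : haar.-integrable setT (EFin \o f) by exact: (integrableZl measurableT i.1 i1).
have E := RintegralD measurableT fi (wsum_integrable s c).
rewrite [LHS]E IH.
have -> : Rintegral haar setT f = i.1 * (if i.2 == (0, 0) then cos c else 0).
  rewrite -Rintegral_wave; exact: (RintegralZl i.1 measurableT i1).
rewrite big_cons; case: ifP => _; last by rewrite mulr0 add0r.
by rewrite mulrDr mulrC.
Qed.

(** Multiplying by the conjugate wave shifts all frequencies, so the coefficient becomes the mean of
    the shifted polynomial [s']. It is real because the imaginary part carries the factor
    [cos (- (pi / 2)) = 0]. *)
Lemma fourier_tpoly s (a b : int) :
  fourier (tpoly s) a b = (\sum_(i <- s | i.2 == (a, b)) i.1)%:C.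
Proof.
pose s' := [seq (i.1, (i.2.1 - a, i.2.2 - b)) | i <- s].
have E t : tpoly s t * expi (- (a%:~R * t.1 + b%:~R * t.2)) = tpoly s' t.
  rewrite /tpoly big_map mulr_suml; apply: eq_bigr => i _ /=.
  rewrite -mulrA; congr (_ * _); rewrite /wave -expiD !intrB; congr expi; ring.
have S : \sum_(i <- s' | i.2 == (0, 0)) i.1 = \sum_(i <- s | i.2 == (a, b)) i.1.
  by rewrite big_map; apply: eq_bigl => -[x [m n]] /=; rewrite !xpair_eqE !subr_eq0.
rewrite /fourier /cint.
have -> : (fun t => complex.Re (tpoly s t * expi (- (a%:~R * t.1 + b%:~R * t.2)))) = wsum s' 0.
  by apply/funext => t; rewrite E Re_tpoly.
have -> : (fun t => complex.Im (tpoly s t * expi (- (a%:~R * t.1 + b%:~R * t.2)))) = wsum s' (- (pi / 2)).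
  by apply/funext => t; rewrite E Im_tpoly.
rewrite !Rintegral_wsum S cos0 cosN -[pi / 2]add0r cosDpihalf sin0 oppr0.
by rewrite mul1r mul0r.
Qed.

Definition nonneg_term (i : R * (int * int)) := (0 <= i.2.1) && (0 <= i.2.2).

Lemma riesz_partial_tpoly s (z1 z2 : R[i]) (N : nat) :
  all (fun i : R * (int * int) => (absz i.2.1 < N)%N && (absz i.2.2 < N)%N) s ->
  riesz_partial (tpoly s) z1 z2 N =
  \sum_(i <- s | nonneg_term i) (i.1)%:C * z1 ^+ absz i.2.1 * z2 ^+ absz i.2.2.
Proof.
move=> sN; rewrite /riesz_partial.
(* With the sum over [s] moved outermost, a term of nonnegative frequency is met by exactly one
   index pair, any other term by none. *)
under eq_bigr do under eq_bigr do
  rewrite fourier_tpoly rmorph_sum/= !mulr_suml big_mkcond/=.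
under eq_bigr do rewrite exchange_big/=.
rewrite exchange_big/= [RHS]big_mkcond/= big_seq [RHS]big_seq.
apply: eq_bigr => -[c [m n]] /(allP sN)/= /andP[mN nN].
case: m mN => m mN; last first.
  by rewrite big1// => a _; rewrite big1// => b _; rewrite xpair_eqE.
case: n nN => n nN; last first.
  by rewrite big1// => a _; rewrite big1// => b _; rewrite xpair_eqE andbF.
rewrite /nonneg_term/= (bigD1 (Ordinal mN))//= (bigD1 (Ordinal nN))//= eqxx.
rewrite !big1 ?addr0// => [a am|b bn].
  rewrite big1// => b _; rewrite xpair_eqE ifF//.
  by apply/negP => /andP[/eqP[E] _]; move/eqP: am; apply; apply/val_inj.
rewrite xpair_eqE ifF//.
by apply/negP => /andP[_ /eqP[E]]; move/eqP: bn; apply; apply/val_inj.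
Qed.

Lemma riesz_hol_tpoly s (z1 z2 : R[i]) :
  riesz_hol (tpoly s) z1 z2 =
  \sum_(i <- s | nonneg_term i) (i.1)%:C * z1 ^+ absz i.2.1 * z2 ^+ absz i.2.2.
Proof.
(* From [K] on all frequencies of [s] are covered, so the partial sums are constant. *)
pose K := (\max_(i <- s) maxn (absz i.2.1) (absz i.2.2)).+1.
have sK (N : nat) : (K <= N)%N ->
    all (fun i : R * (int * int) => (absz i.2.1 < N)%N && (absz i.2.2 < N)%N) s.
  move=> KN; apply/allP => i si.
  rewrite -gtn_max (leq_trans _ KN)// ltnS.
  exact: (@leq_bigmax_seq _ s predT (fun i : R * (int * int) => maxn (absz i.2.1) (absz i.2.2)) i si).
rewrite /riesz_hol; set L := (RHS).
have -> : lim ((fun N => complex.Re (riesz_partial (tpoly s) z1 z2 N)) @ \oo) = complex.Re L.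
  apply/cvg_lim => //; apply: cvg_near_cst; near=> N.
  rewrite riesz_partial_tpoly//; apply: sK; near: N; exact: nbhs_infty_ge.
have -> : lim ((fun N => complex.Im (riesz_partial (tpoly s) z1 z2 N)) @ \oo) = complex.Im L.
  apply/cvg_lim => //; apply: cvg_near_cst; near=> N.
  rewrite riesz_partial_tpoly//; apply: sK; near: N; exact: nbhs_infty_ge.
by case: L.
Unshelve. all: by end_near. Qed.

(** At radius [r] a term of total degree [k] is damped by [r ^ k]. This is polynomial in [r], so the
    radial limit is the value at 1. *)
Lemma riesz_tpoly s t : riesz (tpoly s) t = tpoly [seq i <- s | nonneg_term i] t.
Proof.
pose k (i : R * (int * int)) := (absz i.2.1 + absz i.2.2)%N.
have E (r : R) : riesz_hol (tpoly s) (r%:C * expi t.1) (r%:C * expi t.2) =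
    \sum_(i <- s | nonneg_term i) ((i.1)%:C * wave i.2.1 i.2.2 t) * (r ^+ k i)%:C.
  rewrite riesz_hol_tpoly; apply: eq_bigr => -[c [[m|//] [n|//]]] // _.
  rewrite /k /= !exprMn !expiX exprD rmorphM !rmorphXn /=.
  rewrite /wave expiD -!pmulrn; ring.
rewrite /riesz /tpoly big_filter.
set L := (RHS).
have Rc (f : R -> R) (n : nat) (x : R) : (fun r : R => x * r ^+ n) @ at_left 1 --> x.
  rewrite -[X in _ --> X]mulr1 -[X in x * X](expr1n _ n).
  by apply: cvg_at_left_filter; apply: cvgMr; exact: exprn_continuous.
have Rr (z : R[i]) (x : R) : complex.Re (z * x%:C) = complex.Re z * x.
  by rewrite mulrC Re_realM mulrC.
have Ir (z : R[i]) (x : R) : complex.Im (z * x%:C) = complex.Im z * x.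
  by rewrite mulrC Im_realM mulrC.
have -> : lim ((fun r : R => complex.Re (riesz_hol (tpoly s) (r%:C * expi t.1) (r%:C * expi t.2)))
    @ at_left 1) = complex.Re L.
  apply/cvg_lim => //.
  have -> : (fun r : R => complex.Re (riesz_hol (tpoly s) (r%:C * expi t.1) (r%:C * expi t.2)))
      = fun r => \sum_(i <- s | nonneg_term i)
          complex.Re ((i.1)%:C * wave i.2.1 i.2.2 t) * r ^+ k i.
    by apply/funext => r; rewrite E Re_sum; apply: eq_bigr => i _; rewrite Rr.
  rewrite /L Re_sum.
  by apply: cvg_big => [|i _]; [exact: add_continuous|exact: Rc].
have -> : lim ((fun r : R => complex.Im (riesz_hol (tpoly s) (r%:C * expi t.1) (r%:C * expi t.2)))
    @ at_left 1) = complex.Im L.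
  apply/cvg_lim => //.
  have -> : (fun r : R => complex.Im (riesz_hol (tpoly s) (r%:C * expi t.1) (r%:C * expi t.2)))
      = fun r => \sum_(i <- s | nonneg_term i)
          complex.Im ((i.1)%:C * wave i.2.1 i.2.2 t) * r ^+ k i.
    by apply/funext => r; rewrite E Im_sum; apply: eq_bigr => i _; rewrite Ir.
  rewrite /L Im_sum.
  by apply: cvg_big => [|i _]; [exact: add_continuous|exact: Rc].
by case: L.
Qed.

End TrigonometricPolynomials.

(** * Waves multiplied by polynomials in w *)

Section RieszTriples.
Variable R : realType.
Local Notation haar := (@haar2 R).
Implicit Types (f g : R * R -> R[i]) (c : R) (Q : {poly R}).

(* [riesz_data f g c]: [f] is a trigonometric polynomial with real coefficients,
   [g] is its Riesz projection and [c] its mean. *)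
Definition riesz_data f g c := exists s : seq (R * (int * int)),
  [/\ forall t, f t = tpoly s t,
      forall t, g t = tpoly [seq i <- s | nonneg_term i] t &
      c = \sum_(i <- s | i.2 == (0, 0)) i.1].

Lemma riesz_data_wave (m n : int) :
  riesz_data (wave m n) (fun t => if (0 <= m) && (0 <= n) then wave m n t else 0)
    (if (m == 0) && (n == 0) then 1 else 0).
Proof.
exists [:: (1, (m, n))]; split => [t|t|] /=.
- by rewrite /tpoly big_seq1 mul1r.
- by rewrite /nonneg_term/=; case: ifP => _; rewrite /tpoly ?big_seq1 ?big_nil ?mul1r.
- by rewrite big_mkcond big_seq1.
Qed.

Lemma riesz_data0 : riesz_data (fun=> 0) (fun=> 0) 0.
Proof. by exists [::]; split => [t|t|]; rewrite /tpoly big_nil. Qed.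

Lemma riesz_dataD f g c f' g' c' : riesz_data f g c -> riesz_data f' g' c' ->
  riesz_data (fun t => f t + f' t) (fun t => g t + g' t) (c + c').
Proof.
move=> [s [fs gs cs]] [s' [fs' gs' cs']]; exists (s ++ s'); split => [t|t|].
- by rewrite fs fs' /tpoly big_cat.
- by rewrite filter_cat gs gs' /tpoly big_cat.
- by rewrite cs cs' big_cat.
Qed.

Lemma riesz_dataZ f g c (x : R) : riesz_data f g c ->
  riesz_data (fun t => x%:C * f t) (fun t => x%:C * g t) (x * c).
Proof.
move=> [s [fs gs cs]]; exists [seq (x * i.1, i.2) | i <- s]; split => [t|t|].
- rewrite fs /tpoly big_map mulr_sumr; apply: eq_bigr => i _ /=.
  by rewrite rmorphM mulrA.
- rewrite gs /tpoly !big_filter big_map mulr_sumr; apply: eq_bigr => i _ /=.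
  by rewrite rmorphM mulrA.
- by rewrite cs big_map mulr_sumr.
Qed.

Lemma riesz_data_sum (n : nat) (F G : nat -> R * R -> R[i]) (C : nat -> R) :
  (forall i, riesz_data (F i) (G i) (C i)) ->
  riesz_data (fun t => \sum_(i < n) F i t) (fun t => \sum_(i < n) G i t) (\sum_(i < n) C i).
Proof.
move=> FGC; elim: n => [|n IH].
  have -> : (fun t => \sum_(i < 0) F i t) = fun=> 0 by apply/funext => t; rewrite big_ord0.
  have -> : (fun t => \sum_(i < 0) G i t) = fun=> 0 by apply/funext => t; rewrite big_ord0.
  by rewrite big_ord0; exact: riesz_data0.
have -> : (fun t => \sum_(i < n.+1) F i t) = fun t => \sum_(i < n) F i t + F n t.
  by apply/funext => t; rewrite big_ord_recr.
have -> : (fun t => \sum_(i < n.+1) G i t) = fun t => \sum_(i < n) G i t + G n t.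
  by apply/funext => t; rewrite big_ord_recr.
by rewrite big_ord_recr; exact: riesz_dataD.
Qed.

Lemma riesz_data_eq f g c f' g' c' : riesz_data f g c ->
  f =1 f' -> g =1 g' -> c = c' -> riesz_data f' g' c'.
Proof. by move=> D /funext <- /funext <- <-. Qed.

Lemma riesz_data_riesz f g c : riesz_data f g c -> riesz f = g.
Proof.
move=> [s [/funext -> /funext -> _]]; apply/funext => t; exact: riesz_tpoly.
Qed.

(** Certifies the projection as a trigonometric polynomial in its own right, which yields its
    measurability. *)
Lemma riesz_data_projection f g c : riesz_data f g c -> exists c', riesz_data g g c'.
Proof.
move=> [s [_ gs _]]; eexists; exists [seq i <- s | nonneg_term i]; split => //.
by rewrite filter_id.
Qed.

Lemma measurable_Re_data f g c : riesz_data f g c ->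
  measurable_fun setT (fun t => complex.Re (f t)).
Proof.
move=> [s [/funext -> _ _]].
have -> : (fun t => complex.Re (tpoly s t)) = wsum s 0 by apply/funext => t; rewrite Re_tpoly.
exact: measurable_wsum.
Qed.

Lemma measurable_Im_data f g c : riesz_data f g c ->
  measurable_fun setT (fun t => complex.Im (f t)).
Proof.
move=> [s [/funext -> _ _]].
have -> : (fun t => complex.Im (tpoly s t)) = wsum s (- (pi / 2)).
  by apply/funext => t; rewrite Im_tpoly.
exact: measurable_wsum.
Qed.

Lemma integrable_Re_data f g c : riesz_data f g c ->
  haar.-integrable setT (EFin \o (fun t => complex.Re (f t))).
Proof.
move=> [s [/funext -> _ _]].
have -> : (fun t => complex.Re (tpoly s t)) = wsum s 0 by apply/funext => t; rewrite Re_tpoly.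
exact: wsum_integrable.
Qed.

Lemma Rintegral_Re_data f g c : riesz_data f g c ->
  Rintegral haar setT (fun t => complex.Re (f t)) = c.
Proof.
move=> [s [/funext -> _ ->]].
have -> : (fun t => complex.Re (tpoly s t)) = wsum s 0 by apply/funext => t; rewrite Re_tpoly.
by rewrite Rintegral_wsum cos0 mul1r.
Qed.

(* Evaluation of a real polynomial at [w = (z1 z2)^2]; the square makes every
   positive power of [w] survive the projection after multiplication by
   [z1^2 / z2^2] or [z2^2 / z1^2]. *)
Definition weval Q (t : R * R) : R[i] := (map_poly (real_complex R) Q).[wave 2 2 t].

Lemma wevalE Q t :
  weval Q t = \sum_(j < size Q) (Q`_j)%:C * wave (j.*2)%:Z (j.*2)%:Z t.
Proof.
rewrite /weval horner_coef size_map_poly; apply: eq_bigr => j _.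
rewrite coef_map /=; congr (_ * _); elim: (j : nat) => [|k IH]; first by rewrite wave0.
by rewrite exprS IH waveM doubleS -[k.*2.+2]addn2 PoszD addrC.
Qed.

(** On the torus this is [(z1 / z2) ^ k + (z2 / z1) ^ k]; [osc 1] is the factor [u], and [osc 2] is
    [u ^ 2 - 2]. *)
Definition osc (k : nat) (t : R * R) : R := 2 * cos (2 * pi * (k%:R * (t.1 - t.2))).

Lemma oscE (k : nat) t : (osc k t)%:C = wave k (- k%:Z) t + wave (- k%:Z) k t.
Proof.
rewrite /osc /wave /expi; set x := (X in 2 * cos X).
have -> : 2 * pi * ((k%:Z)%:~R * t.1 + (- k%:Z)%:~R * t.2) = x.
  by rewrite /x mulrNz -!pmulrn; ring.
have -> : 2 * pi * ((- k%:Z)%:~R * t.1 + (k%:Z)%:~R * t.2) = - x.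
  by rewrite /x mulrNz -!pmulrn; ring.
rewrite cosN sinN; apply/eqP; rewrite eq_complex /=.
by apply/andP; split; apply/eqP; ring.
Qed.

Lemma sum_ord_coef0 Q (F : nat -> R[i]) :
  F 0%N = (Q`_0)%:C -> \sum_(j < size Q) (if j == 0 :> nat then F j else 0) = (Q`_0)%:C.
Proof.
case: (posnP (size Q)) => [/eqP|]; last first.
  by case: (size Q) => // n _ F0; rewrite big_ord_recl big1// addr0.
by rewrite size_poly_eq0 => /eqP ->; rewrite size_poly0 big_ord0 coef0.
Qed.

Lemma riesz_data_weval Q : riesz_data (weval Q) (weval Q) (Q`_0).
Proof.
have D j := riesz_dataZ (Q`_j) (riesz_data_wave (j.*2)%:Z (j.*2)%:Z).
apply: (riesz_data_eq (riesz_data_sum (size Q) D)) => [t|t|].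
- by rewrite wevalE.
- by rewrite wevalE; apply: eq_bigr => j _.
- case: (posnP (size Q)) => [/eqP|].
    by rewrite size_poly_eq0 => /eqP ->; rewrite size_poly0 big_ord0 coef0.
  case: (size Q) => // n _; rewrite big_ord_recl mulr1 big1 ?addr0// => i _.
  by rewrite mulr0.
Qed.

(** The product of [osc k] and [w ^ j] has frequencies [2 j + k] and [2 j - k]. For [j = 0] one is
    negative since [k > 0]; for [j >= 1] both are nonnegative since [k <= 2]. So exactly the
    constant coefficient of [Q] is lost. The mean vanishes because [2 j + k] is never 0. *)
Lemma riesz_data_osc (k : nat) Q : (0 < k <= 2)%N ->
  riesz_data (fun t => (osc k t)%:C * weval Q t)
             (fun t => (osc k t)%:C * (weval Q t - (Q`_0)%:C)) 0.
Proof.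
move=> /andP[k0 k2].
have D j := riesz_dataZ (Q`_j) (riesz_dataD
   (riesz_data_wave (k%:Z + (j.*2)%:Z) (- k%:Z + (j.*2)%:Z))
   (riesz_data_wave (- k%:Z + (j.*2)%:Z) (k%:Z + (j.*2)%:Z))).
have E j t : wave (k%:Z + (j.*2)%:Z) (- k%:Z + (j.*2)%:Z) t +
             wave (- k%:Z + (j.*2)%:Z) (k%:Z + (j.*2)%:Z) t =
             (osc k t)%:C * wave (j.*2)%:Z (j.*2)%:Z t.
  by rewrite oscE mulrDl !waveM.
have k1 (j : nat) : (0 <= k%:Z + (j.*2)%:Z) by [].
have kj (j : nat) : (0 <= - k%:Z + (j.*2)%:Z) = (j != 0)%N.
  rewrite addrC subr_ge0 lez_nat; case: j => [|j] /=; first by rewrite leqNgt k0.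
  by rewrite doubleS (leq_trans k2).
apply: (riesz_data_eq (riesz_data_sum (size Q) D)) => [t|t|].
- rewrite wevalE mulr_sumr; apply: eq_bigr => j _; rewrite E; ring.
- pose F (j : nat) := (Q`_j)%:C * wave (j.*2)%:Z (j.*2)%:Z t.
  have F0 : F 0%N = (Q`_0)%:C by rewrite /F wave0 mulr1.
  rewrite wevalE -[X in _ - X](sum_ord_coef0 (F := F) F0) -sumrB mulr_sumr.
  apply: eq_bigr => j _; rewrite !k1 !kj/= andbT.
  case: ifP => [j0|/negbT/negPn/eqP ->]; last by rewrite eqxx subrr addr0 !mulr0.
  by rewrite E (negbTE j0); ring.
- rewrite big1// => j _.
  have -> : (k%:Z + (j.*2)%:Z == 0) = false.
    by apply/negbTE; rewrite -PoszD eqz_nat addn_eq0 negb_and -lt0n k0.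
  by rewrite andbF addr0 mulr0.
Qed.

End RieszTriples.

(** * Polynomials that are almost unimodular on the torus *)

Section Blaschke.
Variable R : realType.

Definition nrm2 (z : R[i]) : R := complex.Re z ^+ 2 + complex.Im z ^+ 2.

Lemma nrm2M (z w : R[i]) : nrm2 (z * w) = nrm2 z * nrm2 w.
Proof. by case: z => a b; case: w => c d; rewrite /nrm2 /=; ring. Qed.

Lemma nrm2_expi (x : R) : nrm2 (expi x) = 1.
Proof. by rewrite /nrm2 /expi /= cos2Dsin2. Qed.

Lemma nrm2X (z : R[i]) (n : nat) : nrm2 (z ^+ n) = nrm2 z ^+ n.
Proof.
elim: n => [|n IH]; first by rewrite /nrm2 /= expr1n expr0n addr0.
by rewrite !exprS nrm2M IH.
Qed.

Lemma nrm2_le (z : R[i]) (D : R) : 0 <= D -> nrm2 z <= D ^+ 2 ->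
  `|complex.Re z| <= D /\ `|complex.Im z| <= D.
Proof.
move=> D0 zD; rewrite -!sqrtr_sqr -(ger0_norm D0) -(sqrtr_sqr D).
by split; apply: ler_wsqrtr; apply: le_trans zD;
  rewrite /nrm2 ?lerDl ?lerDr sqr_ge0.
Qed.

(* Taylor polynomials of the Blaschke factor [(w - a) / (1 - a w)]. *)
Lemma Blaschke_approx (a eta : R) : 0 < a < 1 -> 0 < eta ->
  exists P : {poly R}, P`_0 = - a /\
    forall t, `|nrm2 (weval P t) - 1| <= eta.
Proof.
move=> /andP[a0 a1] eta0.
have a1' : 0 < 1 - a by rewrite subr_gt0.
(* [(1 - a) ^ 2] is the minimum of [|1 - a w| ^ 2] on the circle; 9 covers the error terms collected
   in [Md]. *)
have [N aN] : exists N, a ^+ N <= eta * (1 - a) ^+ 2 / 9.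
  have e0 : 0 < eta * (1 - a) ^+ 2 / 9 by rewrite divr_gt0// mulr_gt0// exprn_gt0.
  have na : `|a| < 1 by rewrite gtr0_norm.
  have /cvgr0Pnorm_le/(_ _ e0)[N _ hN] := cvg_expr na.
  by exists N; apply: le_trans (hN N _) => //=; exact: ler_norm.
(* The Blaschke factor equals [- a + (1 - a ^ 2) w / (1 - a w)]; its geometric series is cut after
   [N] terms. *)
pose P : {poly R} := (- a)%:P + (1 - a ^+ 2) *: ('X * \sum_(j < N) (a *: 'X) ^+ j).
exists P; split.
  by rewrite /P coefD coefC coefZ coefXM mulr0 addr0.
move=> t; set z := wave 2 2 t; set B := weval P t.
have nz : nrm2 z = 1 by exact: nrm2_expi.
(* What the truncation leaves after clearing the denominator [1 - a z]. *)
pose d := ((1 - a ^+ 2) * a ^+ N)%:C * z ^+ N.+1.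
have EB : (1 - a%:C * z) * B = z - a%:C - d.
  rewrite /B /weval -/z /P rmorphD/= map_polyC/= map_polyZ/= rmorphM/= map_polyX rmorph_sum/=.
  rewrite hornerD hornerC hornerZ hornerM hornerX horner_sum.
  have -> : \sum_(j < N) (map_poly (real_complex R) ((a *: 'X) ^+ j)).[z] =
            \sum_(j < N) (a%:C * z) ^+ j.
    apply: eq_bigr => j _; rewrite rmorphXn/= horner_exp map_polyZ/= map_polyX.
    by rewrite hornerZ hornerX.
  have G : (1 - a%:C * z) * \sum_(j < N) (a%:C * z) ^+ j = 1 - (a%:C * z) ^+ N.
    by rewrite -[LHS]opprK -mulNr opprB -subrX1 opprB.
  set S := \sum_(j < N) _ in G *.
  transitivity ((1 - a%:C * z) * (- a)%:C + (1 - a ^+ 2)%:C * z * ((1 - a%:C * z) * S)).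
    by ring.
  have -> : (- a)%:C = - a%:C by rewrite rmorphN.
  have cE : (1 - a ^+ 2)%:C = 1 - a%:C ^+ 2 by rewrite rmorphB rmorph1 rmorphXn.
  have dE : d = (1 - a%:C ^+ 2) * a%:C ^+ N * (z * z ^+ N).
    have rM (x y : R) : (x * y)%:C = x%:C * y%:C by rewrite rmorphM.
    have rX (n : nat) : (a ^+ n)%:C = a%:C ^+ n by rewrite rmorphXn.
    by rewrite /d [z ^+ _]exprS rM rX cE.
  by rewrite G dE cE exprMn; ring.
have D0 : 0 <= (1 - a ^+ 2) * a ^+ N.
  by rewrite mulr_ge0 ?exprn_ge0 ?(ltW a0)// subr_ge0 expr_le1// ltW.
have D1 : (1 - a ^+ 2) * a ^+ N <= a ^+ N.
  by rewrite ler_piMl ?exprn_ge0 ?(ltW a0)// lerBlDr lerDl sqr_ge0.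
have aN1 : a ^+ N <= 1 by rewrite exprn_ile1// ltW.
have [dR dI] : `|complex.Re d| <= a ^+ N /\ `|complex.Im d| <= a ^+ N.
  apply: nrm2_le; first by rewrite exprn_ge0// ltW.
  rewrite /d nrm2M nrm2X nz expr1n mulr1 /nrm2 /= expr0n addr0.
  by rewrite ler_pXn2r// nnegrE ?exprn_ge0// ltW.
have [zR zI] : `|complex.Re z| <= 1 /\ `|complex.Im z| <= 1.
  by apply: nrm2_le; rewrite ?nz ?expr1n.
have := congr1 nrm2 EB; rewrite nrm2M.
have M0 : (1 - a) ^+ 2 <= nrm2 (1 - a%:C * z).
  rewrite /nrm2; move: zR; case: (z) => x y /=; rewrite ler_norml => /andP[x1 x2].
  rewrite -subr_ge0.
  have -> : (1 - (a * x - 0 * y)) ^+ 2 + (0 - (a * y + 0 * x)) ^+ 2 - (1 - a) ^+ 2 =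
    a * (1 - x) * (1 - a * x + 1 - a) + (a * y) ^+ 2 by ring.
  rewrite addr_ge0 ?sqr_ge0// mulr_ge0//; first by rewrite mulr_ge0 ?(ltW a0)// subr_ge0.
  by nra.
(* This is the unimodularity of the exact Blaschke factor; only [d] spoils it for [P]. *)
have Mz : nrm2 (1 - a%:C * z) = nrm2 (z - a%:C).
  move: nz; rewrite /nrm2; case: (z) => x y /= nz.
  apply/eqP; rewrite -subr_eq0; apply/eqP.
  transitivity ((1 - a ^+ 2) * (1 - (x ^+ 2 + y ^+ 2))); first by ring.
  by rewrite nz subrr mulr0.
have Md : `|nrm2 (z - a%:C - d) - nrm2 (z - a%:C)| <= 9 * a ^+ N.
  move: dR dI zR zI; rewrite /nrm2; case: (z) => x y; case: (d) => u v /=.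
  set h := a ^+ N in aN1 *; rewrite !ler_norml => /andP[? ?] /andP[? ?] /andP[? ?] /andP[? ?].
  rewrite !subr0.
  have -> : (x - a - u) ^+ 2 + (y - v) ^+ 2 - ((x - a) ^+ 2 + y ^+ 2) =
    u * u + v * v - 2 * (x - a) * u - 2 * y * v by ring.
  have h0 : 0 <= h by lra.
  have uu : - (h * 1) <= u * u <= h * 1 by apply/andP; split; nra.
  have vv : - (h * 1) <= v * v <= h * 1 by apply/andP; split; nra.
  have xu : - (2 * h) <= (x - a) * u <= 2 * h by apply/andP; split; nra.
  have yv : - h <= y * v <= h by apply/andP; split; nra.
  by apply/andP; split; lra.
set m := nrm2 (1 - a%:C * z) in M0 Mz *.
move=> E.
have m0 : 0 < m by apply: lt_le_trans M0; rewrite exprn_gt0.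
rewrite -(ler_pM2l m0) -{1}(ger0_norm (ltW m0)) -normrM mulrBr mulr1 E Mz.
apply: (le_trans Md); rewrite -Mz.
apply: (@le_trans _ _ ((1 - a) ^+ 2 * eta)); last by rewrite ler_wpM2r// ltW.
by move: aN; rewrite ler_pdivlMr// mulrC [eta * _]mulrC.
Qed.

End Blaschke.

(** * Taylor expansions *)

Section NormBounds.
Variable R : realType.

Lemma norm_leM (a b A B : R) : `|a| <= A -> `|b| <= B -> `|a * b| <= A * B.
Proof. by move=> aA bB; rewrite normrM ler_pM. Qed.

Lemma norm_leD (a b A B : R) : `|a| <= A -> `|b| <= B -> `|a + b| <= A + B.
Proof. by move=> aA bB; apply: (le_trans (ler_normD _ _)); exact: lerD. Qed.

Lemma norm_leN (a A : R) : `|a| <= A -> `|- a| <= A.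
Proof. by rewrite normrN. Qed.

Lemma norm_leX (a A : R) (n : nat) : `|a| <= A -> `|a ^+ n| <= A ^+ n.
Proof. by move=> aA; rewrite normrX lerXn2r// nnegrE (le_trans _ aA). Qed.

End NormBounds.

(** Follows the syntax of the bounded expression, putting a bound in place of each atom. The
    constants below therefore copy the shape of the expressions they bound. *)
Ltac norm_le :=
  repeat first [ assumption | exact: lexx | apply: norm_leM | apply: norm_leD
               | apply: norm_leN | apply: norm_leX ].

Section Taylor.
Variable R : realType.

(** By the mean value theorem [f x = df z * x] with [|z| <= |x|]. The factor [1 / (n + 1)] of
    integration is given away; iteration bounds Taylor remainders. *)
Lemma derive_norm_bound (f df : R -> R) (M c : R) (n : nat) :
  f 0 = 0 -> (forall x, `|x| <= c -> is_derive x (1 : R) f (df x)) ->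
  (forall x, `|x| <= c -> `|df x| <= M * `|x| ^+ n) ->
  forall x, `|x| <= c -> `|f x| <= M * `|x| ^+ n.+1.
Proof.
move=> f0 fd dM x xc.
have cont y : `|y| <= c -> {for y, continuous f}.
  move=> yc; apply: differentiable_continuous; apply/derivable1_diffP.
  by case: (fd y yc).
have M0 (y : R) : `|y| <= c -> 0 <= M * `|y| ^+ n.
  by move=> yc; apply: le_trans (dM y yc).
have [z [zx fz]] : exists z, `|z| <= `|x| /\ f x = df z * x.
  case: (leP 0 x) => x0.
    have sub z : z \in `[0, x] -> `|z| <= `|x|.
      by rewrite in_itv/= => /andP[z0 zx]; rewrite !ger0_norm.
    have [||z zI] := @MVT_segment _ f df 0 x x0.
    - by move=> z zI; apply: fd; apply: le_trans xc; apply: sub; exact: subset_itv_oo_cc.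
    - apply: continuous_in_subspaceT => z; rewrite inE/= => zI.
      by apply: cont; apply: le_trans xc; exact: sub.
    by rewrite f0 !subr0 => fz; exists z; split; [exact: sub|].
  have sub z : z \in `[x, 0] -> `|z| <= `|x|.
    by rewrite in_itv/= => /andP[xz z0]; rewrite (ltr0_norm x0) ler0_norm// lerN2.
  have [||z zI] := @MVT_segment _ f df x 0 (ltW x0).
  - by move=> z zI; apply: fd; apply: le_trans xc; apply: sub; exact: subset_itv_oo_cc.
  - apply: continuous_in_subspaceT => z; rewrite inE/= => zI.
    by apply: cont; apply: le_trans xc; exact: sub.
  rewrite f0 !sub0r mulrN => /oppr_inj fz; exists z; split; [exact: sub|exact: fz].
have zc := le_trans zx xc.
rewrite fz normrM exprSr mulrA ler_wpM2r// (le_trans (dM z zc))//.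
(* A negative [M] forces [|x| ^ n = 0], and then [|z| ^ n = 0] too. *)
have [M0'|M0'] := leP 0 M; first by rewrite ler_wpM2l// lerXn2r.
have := M0 _ xc; rewrite nmulr_rge0// => xn0.
have xn : `|x| ^+ n = 0 by apply/eqP; rewrite eq_le xn0 exprn_ge0.
have zn : `|z| ^+ n = 0.
  by apply/eqP; rewrite eq_le exprn_ge0// andbT -xn lerXn2r.
by rewrite xn zn.
Qed.

Lemma expR_taylor3 (x : R) : `|x| <= 1 ->
  `|expR x - 1 - x - x ^+ 2 / 2| <= expR 1 * `|x| ^+ 3.
Proof.
move: x; apply: (@derive_norm_bound (fun x => expR x - 1 - x - x ^+ 2 / 2)
  (fun x => expR x - 1 - x) _ 1).
- by rewrite expR0 expr0n/= mul0r !subr0 subrr.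
- move=> x _; apply: is_derive_eq.
  by rewrite /GRing.scale /=; field.
apply: (@derive_norm_bound _ (fun x => expR x - 1)).
- by rewrite expR0 subrr subr0.
- by move=> x _; apply: is_derive_eq; rewrite subr0.
apply: (@derive_norm_bound _ expR).
- by rewrite expR0 subrr.
- by move=> x _; apply: is_derive_eq; rewrite subr0.
move=> x; rewrite ler_norml => /andP[_ x1].
by rewrite expr0 mulr1 ger0_norm ?expR_ge0// ler_expR.
Qed.

Lemma ln_taylor3 (x : R) : `|x| <= 2^-1 ->
  `|ln (1 + x) - x + x ^+ 2 / 2| <= 2 * `|x| ^+ 3.
Proof.
move: x; apply: (@derive_norm_bound (fun x => ln (1 + x) - x + x ^+ 2 / 2)
  (fun x => (1 + x)^-1 - 1 + x) _ 2^-1).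
- by rewrite addr0 ln1 expr0n/= mul0r subr0 addr0.
- move=> x; rewrite ler_norml => /andP[x1 x2].
  have x0 : 0 < 1 + x by lra.
  have dl := is_derive1_ln x0.
  have d1 : is_derive x (1 : R) (fun x : R => 1 + x) 1 by apply: is_derive_eq; rewrite add0r mulr1.
  have dc : is_derive x (1 : R) (fun x => ln (1 + x)) ((1 + x)^-1 * 1) :=
    is_derive1_comp dl d1.
  apply: is_derive_eq.
  by rewrite /GRing.scale /=; field; rewrite gt_eqF.
- move=> x; rewrite ler_norml => /andP[x1 x2].
  have x0 : 0 < 1 + x by lra.
  (* The derivative of the remainder is already quadratic; the constant 2 comes from
     [1 + x >= 1 / 2]. *)
  have -> : (1 + x)^-1 - 1 + x = x ^+ 2 / (1 + x) by field; rewrite gt_eqF.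
  rewrite normrM normfV (ger0_norm (ltW x0)) normrX mulrC ler_wpM2r ?exprn_ge0//.
  by rewrite -[leRHS]invrK lef_pV2 ?posrE ?invr_gt0//; lra.
Qed.

(** The Taylor formula is applied to [z = e * th], with [e0] keeping [|z| <= 1 / 2]. Halving passes
    from a squared modulus to the modulus. [C] and [e0] depend on [M] only, so the estimate is
    uniform over the torus. *)
Lemma half_ln_expansion (M : R) : exists C e0 : R, [/\ 0 < e0, e0 <= 1 &
  forall e T1 T2 s : R, 0 < e <= e0 -> `|T1| <= M -> `|T2| <= M -> `|s| <= M ->
  let v := 1 + e * T1 + e ^+ 2 * T2 + e ^+ 3 * s in
  0 < v /\ `|ln v / 2 - (e * (T1 / 2) + e ^+ 2 * (T2 / 2 - T1 ^+ 2 / 4))| <= C * e ^+ 3].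
Proof.
pose K := `|M| + 1 * `|M| + 1 ^+ 2 * `|M|.
have K0 : 0 <= K by rewrite /K !addr_ge0 ?mulr_ge0 ?exprn_ge0.
pose m := `|M|.
pose C := m * `|2^-1 : R| + (`|2 : R| * m * m + `|2 : R| * 1 * m * m + 1 * m ^+ 2 +
  `|2 : R| * 1 ^+ 2 * m * m + 1 ^+ 3 * m ^+ 2) * `|4^-1 : R|.
exists (K ^+ 3 + C), (2 * (K + 1))^-1.
have K1 : 1 <= 2 * (K + 1) by lra.
split; [by rewrite invr_gt0; lra|by rewrite invf_le1//; lra|].
move=> e T1 T2 s /andP[e0 eK] T1M T2M sM v.
have e1 : `|e| <= 1.
  by rewrite gtr0_norm// (le_trans eK)// invf_le1//; lra.
have MM : M <= `|M| by exact: ler_norm.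
have {T1M}T1M := le_trans T1M MM; have {T2M}T2M := le_trans T2M MM.
have {sM}sM := le_trans sM MM.
pose th := T1 + e * T2 + e ^+ 2 * s.
have thK : `|th| <= K by rewrite /th /K; norm_le.
pose z := e * th.
have zE : v = 1 + z by rewrite /v /z /th; ring.
have z2 : `|z| <= 2^-1.
  rewrite /z normrM gtr0_norm//; apply: (@le_trans _ _ ((2 * (K + 1))^-1 * (K + 1))).
    by apply: ler_pM => //; [exact: ltW|lra].
  by rewrite invfM -mulrA mulVf ?mulr1//; lra.
have v0 : 0 < v by rewrite zE; move: z2; rewrite ler_norml => /andP[? _]; lra.
split => //.
have := ln_taylor3 z2; rewrite -zE => lnb.
have E : ln v / 2 - (e * (T1 / 2) + e ^+ 2 * (T2 / 2 - T1 ^+ 2 / 4)) =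
  (ln v - z + z ^+ 2 / 2) * 2^-1 +
  e ^+ 3 * (s * 2^-1 - (2 * T1 * T2 + 2 * e * T1 * s + e * T2 ^+ 2 +
     2 * e ^+ 2 * T2 * s + e ^+ 3 * s ^+ 2) * 4^-1).
  by rewrite /z /th; field.
rewrite E; apply: (le_trans (ler_normD _ _)).
rewrite [leRHS]mulrDl; apply: lerD.
  rewrite normrM (@ger0_norm _ 2^-1) ?invr_ge0// ler_pdivrMr//.
  apply: (le_trans lnb); rewrite mulrC ler_wpM2r// /z normrM exprMn (gtr0_norm e0) mulrC.
  by rewrite ler_wpM2r ?exprn_ge0 ?(ltW e0)// lerXn2r// nnegrE.
rewrite mulrC normrM (@ger0_norm _ (e ^+ 3)) ?exprn_ge0 ?(ltW e0)//.
rewrite ler_wpM2r ?exprn_ge0 ?(ltW e0)//.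
by rewrite /C /m; norm_le.
Qed.

(** Serves for [r]-th powers, written as the exponential of [r] times an expanded logarithm; [e0]
    keeps the exponent in [[-1, 1]]. *)
Lemma expR_expansion (M r : R) : exists C e0 : R, [/\ 0 < e0, e0 <= 1 &
  forall e L1 L2 s : R, 0 < e <= e0 -> `|L1| <= M -> `|L2| <= M -> `|s| <= M ->
  `|expR (r * (e * L1 + e ^+ 2 * L2 + e ^+ 3 * s)) -
    (1 + e * (r * L1) + e ^+ 2 * (r * L2 + r ^+ 2 * L1 ^+ 2 / 2))| <= C * e ^+ 3].
Proof.
pose K := `|r| * (`|M| + 1 * `|M| + 1 ^+ 2 * `|M|).
have K0 : 0 <= K by rewrite /K mulr_ge0// !addr_ge0 ?mulr_ge0 ?exprn_ge0.
pose m := `|M|.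
pose C := `|r| * m + `|r| ^+ 2 * (`|2 : R| * m * m + `|2 : R| * 1 * m * m + 1 * m ^+ 2 +
  `|2 : R| * 1 ^+ 2 * m * m + 1 ^+ 3 * m ^+ 2) * `|2^-1 : R|.
exists (expR 1 * K ^+ 3 + C), (K + 1)^-1.
have K1 : 1 <= K + 1 by lra.
split; [by rewrite invr_gt0; lra|by rewrite invf_le1//; lra|].
move=> e L1 L2 s /andP[e0 eK] T1M T2M sM.
have e1 : `|e| <= 1.
  by rewrite gtr0_norm// (le_trans eK)// invf_le1//; lra.
have MM : M <= `|M| by exact: ler_norm.
have {T1M}T1M := le_trans T1M MM; have {T2M}T2M := le_trans T2M MM.
have {sM}sM := le_trans sM MM.
pose th := r * (L1 + e * L2 + e ^+ 2 * s).
have thK : `|th| <= K by rewrite /th /K; norm_le.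
pose z := e * th.
have zE : r * (e * L1 + e ^+ 2 * L2 + e ^+ 3 * s) = z by rewrite /z /th; ring.
have z1 : `|z| <= 1.
  rewrite /z normrM gtr0_norm//; apply: (@le_trans _ _ ((K + 1)^-1 * (K + 1))).
    by apply: ler_pM => //; [exact: ltW|lra].
  by rewrite mulVf//; lra.
have := expR_taylor3 z1; rewrite zE => lnb.
have E : expR z - (1 + e * (r * L1) + e ^+ 2 * (r * L2 + r ^+ 2 * L1 ^+ 2 / 2)) =
  (expR z - 1 - z - z ^+ 2 / 2) +
  e ^+ 3 * (r * s + r ^+ 2 * (2 * L1 * L2 + 2 * e * L1 * s + e * L2 ^+ 2 +
     2 * e ^+ 2 * L2 * s + e ^+ 3 * s ^+ 2) * 2^-1).
  by rewrite /z /th; field.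
rewrite E; apply: (le_trans (ler_normD _ _)).
rewrite [leRHS]mulrDl; apply: lerD.
  apply: (le_trans lnb); rewrite -mulrA ler_wpM2l ?expR_ge0// /z normrM exprMn (gtr0_norm e0) mulrC.
  by rewrite ler_wpM2r ?exprn_ge0 ?(ltW e0)// lerXn2r// nnegrE.
rewrite mulrC normrM (@ger0_norm _ (e ^+ 3)) ?exprn_ge0 ?(ltW e0)//.
rewrite ler_wpM2r ?exprn_ge0 ?(ltW e0)//.
by rewrite /C /m; norm_le.
Qed.

End Taylor.

(** * Second-order expansion of the logarithm of a modulus *)

Section LogModulus.
Variable R : realType.

Lemma ln_cabs (z : R[i]) : ln (cabs z) = ln (nrm2 z) / 2.
Proof.
have n0 : 0 <= nrm2 z by rewrite addr_ge0 ?sqr_ge0.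
by rewrite /cabs -/(nrm2 z) -powR12_sqrt// ln_powR mulrC.
Qed.

Lemma cabs_gt0 (z : R[i]) : (0 < cabs z) = (0 < nrm2 z).
Proof. by rewrite /cabs -/(nrm2 z) sqrtr_gt0. Qed.

(** Formally [F = B (1 + e u (x B + y / B) + e ^ 2 W / B)], where [1 / B] is nearly the conjugate of
    [B]. Division is avoided by expanding [nrm2 F] in powers of [e]. *)
Lemma ln_cabs_expansion (x y K : R) : exists C e0 : R, [/\ 0 < e0, e0 <= 1 &
  forall (e u : R) (B W : R[i]), 0 < e <= e0 -> `|nrm2 B - 1| <= e ^+ 3 ->
  `|u| <= 2 -> `|complex.Re W| <= K -> `|complex.Im W| <= K ->
  let F := B + (e * u)%:C * (x%:C * B ^+ 2 + y%:C) + (e ^+ 2)%:C * W in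
  0 < cabs F /\
  `|ln (cabs F) -
    (e * (u * (x + y) * complex.Re B) +
     e ^+ 2 * ((complex.Re B * complex.Re W + complex.Im B * complex.Im W) -
       u ^+ 2 * (x * y + complex.Re (B ^+ 2) * (x ^+ 2 + y ^+ 2) / 2)))| <= C * e ^+ 3].
Proof.
pose k := `|x| + `|y| + `|K| + 2.
have [hx hy hK] : [/\ 0 <= `|x|, 0 <= `|y| & 0 <= `|K|] by [].
have k2 : 2 <= k by rewrite /k; lra.
pose M1 := k * (k * (k + k) * k).
pose M2 := k ^+ 2 * (k ^+ 2 + k ^+ 2 + k * k * k * (k ^+ 2 + k ^+ 2)) + k * (k * k + k * k).
pose M3 := k + k * (k * k * k * k * k) + k ^+ 2 * k ^+ 2 * k ^+ 2 * (k * k + k ^+ 3 * k ^+ 2)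
  + k * k * ((k * (k ^+ 2 + k ^+ 2) + k) * k + k * k * k * k * k) + k * (k ^+ 2 + k ^+ 2).
pose M4 := k ^+ 2 * k ^+ 2 * (k + k) ^+ 2 * k * `|2^-1 : R|.
have [C [e0 [e00 e01 H]]] := half_ln_expansion (M1 + M2 + M3).
have k0 : 0 <= k by lra.
have M10 : 0 <= M1 by rewrite /M1 !(mulr_ge0, addr_ge0).
have M20 : 0 <= M2 by rewrite /M2 !(mulr_ge0, addr_ge0, exprn_ge0).
have M30 : 0 <= M3 by rewrite /M3 !(mulr_ge0, addr_ge0, exprn_ge0).
exists (C + M4), e0; split => //.
move=> e u B W /andP[ep ee0] hN hu hW1 hW2 F.
have e3 : 0 < e ^+ 3 by rewrite exprn_gt0.
have e31 : e ^+ 3 <= 1 by rewrite exprn_ile1// ?(ltW ep)// (le_trans ee0).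
have ek : `|e| <= k by rewrite gtr0_norm//; lra.
have uk : `|u| <= k by lra.
have xk : `|x| <= k by rewrite /k; lra.
have yk : `|y| <= k by rewrite /k; lra.
have tk : `|2 : R| <= k by rewrite ger0_norm.
have Kk : K <= k by rewrite /k; have := ler_norm K; lra.
have {hW1}hW1 := le_trans hW1 Kk; have {hW2}hW2 := le_trans hW2 Kk.
have [hB1 hB2] : `|complex.Re B| <= k /\ `|complex.Im B| <= k.
  have [] := @nrm2_le _ B 2; first by [].
    by move: hN; rewrite ler_norml => /andP[_ hN]; lra.
  by split; lra.
rewrite ln_cabs cabs_gt0.
case: B @F hN hB1 hB2 => b1 b2; case: W hW1 hW2 => w1 w2 hw1 hw2 F hN hb1 hb2.
rewrite /= in hw1 hw2 hb1 hb2 *.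
pose N := b1 ^+ 2 + b2 ^+ 2.
(* The defect of unimodularity, rescaled to be bounded; it enters only terms of order [e ^ 3] and
   higher. *)
pose d := (N - 1) / e ^+ 3.
have Nd : N = 1 + e ^+ 3 * d by rewrite /d; field; rewrite gt_eqF.
have dk : `|d| <= k.
  apply: (@le_trans _ _ 1); last by lra.
  by rewrite /d normrM normfV (gtr0_norm e3) ler_pdivrMr// mul1r.
pose T1 := 2 * (u * (x + y) * b1).
pose T2 := u ^+ 2 * (x ^+ 2 + y ^+ 2 + 2 * x * y * (b1 ^+ 2 - b2 ^+ 2)) + 2 * (b1 * w1 + b2 * w2).
pose s := d + e * (2 * u * x * b1 * d) + e ^+ 2 * u ^+ 2 * x ^+ 2 * (2 * d + e ^+ 3 * d ^+ 2)
  + 2 * u * ((x * (b1 ^+ 2 - b2 ^+ 2) + y) * w1 + 2 * x * b1 * b2 * w2) + e * (w1 ^+ 2 + w2 ^+ 2).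
have hT1 : `|T1| <= M1 + M2 + M3.
  by rewrite (@le_trans _ _ M1)//; [rewrite /T1 /M1; norm_le|lra].
have hT2 : `|T2| <= M1 + M2 + M3.
  by rewrite (@le_trans _ _ M2)//; [rewrite /T2 /M2; norm_le|lra].
have hs : `|s| <= M1 + M2 + M3.
  by rewrite (@le_trans _ _ M3)//; [rewrite /s /M3; norm_le|lra].
have ee : 0 < e <= e0 by rewrite ep ee0.
have FE : nrm2 F = 1 + e * T1 + e ^+ 2 * T2 + e ^+ 3 * s.
  transitivity (N + 2 * e * u * (x * N + y) * b1 +
    e ^+ 2 * (u ^+ 2 * (x ^+ 2 * N ^+ 2 + y ^+ 2 + 2 * x * y * (b1 ^+ 2 - b2 ^+ 2))
      + 2 * (b1 * w1 + b2 * w2)) +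
    2 * e ^+ 3 * u * ((x * (b1 ^+ 2 - b2 ^+ 2) + y) * w1 + 2 * x * b1 * b2 * w2) +
    e ^+ 4 * (w1 ^+ 2 + w2 ^+ 2)).
    by rewrite /nrm2 /F /N /=; ring.
  by rewrite Nd /T1 /T2 /s; ring.
have [v0 vb] := H e T1 T2 s ee hT1 hT2 hs.
rewrite FE; split => //.
set L := ln _ / 2 in vb *.
(* [T1 ^ 2] involves [b1 ^ 2 = (N + Re (B ^ 2)) / 2]; replacing [N] by 1 there costs the term
   bounded by [M4]. *)
have E : L - (e * (u * (x + y) * b1) + e ^+ 2 * (b1 * w1 + b2 * w2 -
      u ^+ 2 * (x * y + (b1 * b1 - b2 * b2) * (x ^+ 2 + y ^+ 2) / 2))) =
  (L - (e * (T1 / 2) + e ^+ 2 * (T2 / 2 - T1 ^+ 2 / 4))) -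
  (e ^+ 2 * u ^+ 2 * (x + y) ^+ 2 * d * 2^-1) * e ^+ 3.
  have -> : (e ^+ 2 * u ^+ 2 * (x + y) ^+ 2 * d * 2^-1) * e ^+ 3 =
     e ^+ 2 * u ^+ 2 * (x + y) ^+ 2 * (N - 1) * 2^-1 by rewrite Nd; ring.
  by rewrite /T1 /T2 /N /=; field.
rewrite E (le_trans (ler_normB _ _))// [leRHS]mulrDl lerD//.
rewrite normrM (gtr0_norm e3) ler_wpM2r ?(ltW e3)//.
by rewrite /M4; norm_le.
Qed.

End LogModulus.

(** * The perturbed Blaschke factor *)

Section Perturbation.
Variable R : realType.

(* [B] is nearly unimodular and [u] is the real factor [z1 / z2 + z2 / z1];
   [z] will be the constant coefficient of the part of [B - B ^ 3] that
   the Riesz projection removes. *)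
Definition perturbed (x y kap z e u : R) (B : R[i]) : R[i] :=
  B + (e * u)%:C * (x%:C * B ^+ 2 + y%:C) +
  (e ^+ 2)%:C * (kap%:C * ((u ^+ 2)%:C * (B - B ^+ 3) - ((u ^+ 2 - 2) * z)%:C)).

(** The coefficient of [e ^ 2] in the logarithm of the modulus of [perturbed] when [|B| = 1]. There
    [1 - Re (B ^ 2)] is the real part of [B - B ^ 3] times the conjugate of [B]. *)
Definition second_order (x y kap z u : R) (B : R[i]) : R :=
  kap * (u ^+ 2 * (1 - complex.Re (B ^+ 2)) - (u ^+ 2 - 2) * z * complex.Re B) -
  u ^+ 2 * (x * y + complex.Re (B ^+ 2) * (x ^+ 2 + y ^+ 2) / 2).

Definition log_main (x y kap z e u : R) (B : R[i]) : R :=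
  e * (u * (x + y) * complex.Re B) + e ^+ 2 * second_order x y kap z u B.

(* [r0 = 1], [r1 = 0] approximates the logarithm of the modulus, while
   [r0 = r], [r1 = r ^ 2] approximates its [r]-th power minus 1. *)
Definition gen_main (x y kap z r0 r1 e u : R) (B : R[i]) : R :=
  r0 * log_main x y kap z e u B +
  e ^+ 2 * (r1 * u ^+ 2 * (x + y) ^+ 2 * (1 + complex.Re (B ^+ 2)) / 4).

Lemma norm_ReIm_le2 (B : R[i]) (e : R) : 0 < e <= 1 -> `|nrm2 B - 1| <= e ^+ 3 ->
  `|complex.Re B| <= 2 /\ `|complex.Im B| <= 2.
Proof.
move=> /andP[e0 e1]; rewrite ler_norml => /andP[_ hN]; apply: nrm2_le => //.
have e31 : e ^+ 3 <= 1 by rewrite exprn_ile1// ltW.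
by lra.
Qed.

Lemma log_expansion (x y kap z : R) : exists C e0 : R, [/\ 0 < e0, e0 <= 1 &
  forall (e u : R) (B : R[i]), 0 < e <= e0 -> `|nrm2 B - 1| <= e ^+ 3 -> `|u| <= 2 ->
  0 < cabs (perturbed x y kap z e u B) /\
  `|ln (cabs (perturbed x y kap z e u B)) - log_main x y kap z e u B| <= C * e ^+ 3].
Proof.
pose K := `|kap| * (2 ^+ 2 * (2 + (2 ^+ 3 + 3 * 2 * 2 ^+ 2)) + (2 ^+ 2 + 2) * `|z|).
have [C [e0 [e00 e01 H]]] := ln_cabs_expansion x y K.
pose C' := `|kap| * (2 ^+ 2 * (1 + (2 * 2 + 2 * 2))).
exists (C + C'), e0; split => // e u B ee hN hu.
have ee1 : 0 < e <= 1 by case/andP: ee => -> /le_trans ->.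
have [hb1 hb2] := norm_ReIm_le2 ee1 hN.
have t2 : `|2 : R| <= 2 by rewrite ger0_norm.
have t3 : `|3 : R| <= 3 by rewrite ger0_norm.
have t1 : `|1 : R| <= 1 by rewrite ger0_norm.
pose W : R[i] := kap%:C * ((u ^+ 2)%:C * (B - B ^+ 3) - ((u ^+ 2 - 2) * z)%:C).
have [|| F0 hF] := H e u B W ee hN hu.
- rewrite /W; case: (B) hb1 hb2 => b1 b2 /= hb1 hb2.
  rewrite [X in `|X| <= _](_ : _ = kap * (u ^+ 2 * (b1 + - (b1 ^+ 3 + - (3 * b1 * b2 ^+ 2))) +
    - ((u ^+ 2 + - 2) * z))); last by ring.
  by rewrite /K; norm_le.
- rewrite /W; case: (B) hb1 hb2 => b1 b2 /= hb1 hb2.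
  rewrite [X in `|X| <= _](_ : _ = kap * (u ^+ 2 * (b2 + (b2 ^+ 3 + - (3 * b2 * b1 ^+ 2))) + 0)); last by ring.
  rewrite /K; apply: norm_leM => //; apply: norm_leD; first by norm_le.
  by rewrite normr0 mulr_ge0.
split => //; rewrite /log_main.
set L := ln _ in hF *.
(* The contribution of [B - B ^ 3] carries a factor [nrm2 B] where [second_order] has 1; the
   difference is absorbed in the error. *)
have -> : L - (e * (u * (x + y) * complex.Re B) + e ^+ 2 * second_order x y kap z u B) =
  (L - (e * (u * (x + y) * complex.Re B) + e ^+ 2 *
   (complex.Re B * complex.Re W + complex.Im B * complex.Im W -
       u ^+ 2 * (x * y + complex.Re (B ^+ 2) * (x ^+ 2 + y ^+ 2) / 2)))) +
  e ^+ 2 * ((nrm2 B - 1) * (kap * (u ^+ 2 * (1 + - complex.Re (B ^+ 2))))).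
  rewrite /second_order /W /nrm2; case: (B) => b1 b2 /=; ring.
rewrite (le_trans (ler_normD _ _))// [leRHS]mulrDl lerD//.
rewrite -[leRHS]mul1r; apply: norm_leM.
  rewrite normrX exprn_ile1// gtr0_norm//; by case/andP: ee1.
rewrite [leRHS]mulrC; apply: norm_leM => //.
rewrite (_ : complex.Re (B ^+ 2) = complex.Re B * complex.Re B + - (complex.Im B * complex.Im B)); last by case: (B).
by rewrite /C'; norm_le.
Qed.

(** Exponentiating [r] times the logarithm adds the square of the first-order term. It contains
    [(Re B) ^ 2], which is [(1 + Re (B ^ 2)) / 2] up to [nrm2 B - 1]; hence the [r1] term of
    [gen_main]. *)
Lemma pow_expansion (x y kap z r : R) : exists C e0 : R, [/\ 0 < e0, e0 <= 1 &
  forall (e u : R) (B : R[i]), 0 < e <= e0 -> `|nrm2 B - 1| <= e ^+ 3 -> `|u| <= 2 ->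
  `|cabs (perturbed x y kap z e u B) `^ r - (1 + gen_main x y kap z r (r ^+ 2) e u B)| <= C * e ^+ 3].
Proof.
have [C1 [e1 [e10 e11 H1]]] := log_expansion x y kap z.
pose M1 := 2 * (`|x| + `|y|) * 2.
pose M2 := `|kap| * (2 ^+ 2 * (1 + (2 * 2 + 2 * 2)) + (2 ^+ 2 + 2) * `|z| * 2) +
  2 ^+ 2 * (`|x| * `|y| + (2 * 2 + 2 * 2) * (`|x| ^+ 2 + `|y| ^+ 2) * `|2^-1 : R|).
have M10 : 0 <= M1 by rewrite /M1 !(mulr_ge0, addr_ge0).
have M20 : 0 <= M2 by rewrite /M2 !(mulr_ge0, addr_ge0, exprn_ge0).
have [C2 [e2 [e20 e21 H2]]] := expR_expansion (M1 + M2 + `|C1|) r.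
pose C3 := `|r| ^+ 2 * 2 ^+ 2 * (`|x| + `|y|) ^+ 2 * `|4^-1 : R|.
exists (C2 + C3), (Num.min e1 e2); split; [by rewrite lt_min e10|by rewrite ge_min e11|].
move=> e u B /andP[e0]; rewrite le_min => /andP[ee1 ee2] hN hu.
have ee : 0 < e <= 1 by rewrite e0 (le_trans ee1).
have e3 : 0 < e ^+ 3 by rewrite exprn_gt0.
have [hb1 hb2] := norm_ReIm_le2 ee hN.
have [|F0 hF] := H1 e u B _ hN hu; first by rewrite e0.
set F := perturbed _ _ _ _ _ _ _ in F0 hF *.
have t2 : `|2 : R| <= 2 by rewrite ger0_norm.
have t1 : `|1 : R| <= 1 by rewrite ger0_norm.
have RB : complex.Re (B ^+ 2) = complex.Re B * complex.Re B + - (complex.Im B * complex.Im B).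
  by case: (B).
pose L1 := u * (x + y) * complex.Re B.
pose L2 := second_order x y kap z u B.
pose s := (ln (cabs F) - log_main x y kap z e u B) / e ^+ 3.
have hL1 : `|L1| <= M1 + M2 + `|C1|.
  apply: (@le_trans _ _ M1); last by rewrite -addrA lerDl addr_ge0.
  by rewrite /L1 /M1; norm_le.
have hL2 : `|L2| <= M1 + M2 + `|C1|.
  apply: (@le_trans _ _ M2); last by rewrite addrAC lerDr addr_ge0.
  by rewrite /L2 /M2 /second_order RB; norm_le.
have hs : `|s| <= M1 + M2 + `|C1|.
  apply: (@le_trans _ _ `|C1|); last by rewrite lerDr addr_ge0.
  rewrite /s normrM normfV (gtr0_norm e3) ler_pdivrMr// (le_trans hF)//.
  by rewrite ler_wpM2r ?(ltW e3)// ler_norm.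
have ee' : 0 < e <= e2 by rewrite e0.
have hE := H2 e L1 L2 s ee' hL1 hL2 hs.
have lnE : ln (cabs F) = e * L1 + e ^+ 2 * L2 + e ^+ 3 * s.
  by rewrite /s /L1 /L2 /log_main; field; rewrite gt_eqF.
have -> : cabs F `^ r = expR (r * (e * L1 + e ^+ 2 * L2 + e ^+ 3 * s)).
  by rewrite -lnE /powR gt_eqF.
set X := expR _.
have -> : X - (1 + gen_main x y kap z r (r ^+ 2) e u B) =
  (X - (1 + e * (r * L1) + e ^+ 2 * (r * L2 + r ^+ 2 * L1 ^+ 2 / 2))) +
  e ^+ 2 * ((nrm2 B - 1) * (r ^+ 2 * u ^+ 2 * (x + y) ^+ 2 * 4^-1)).
  by rewrite /gen_main /log_main -/L2 RB /nrm2 /L1; field.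
rewrite (le_trans (ler_normD _ _))// [leRHS]mulrDl lerD//.
rewrite -[leRHS]mul1r; apply: norm_leM.
  rewrite normrX exprn_ile1// gtr0_norm//; by case/andP: ee.
rewrite [leRHS]mulrC; apply: norm_leM => //.
by rewrite /C3; norm_le.
Qed.

End Perturbation.

(** * Second-order expansion of the norms *)

Section NormExpansion.
Variable R : realType.
Local Notation haar := (@haar2 R).

Lemma Rintegral_near (f g : R * R -> R) (eta : R) :
  measurable_fun setT f -> haar.-integrable setT (EFin \o g) ->
  (forall t, `|f t - g t| <= eta) ->
  haar.-integrable setT (EFin \o f) /\
  `|Rintegral haar setT f - Rintegral haar setT g| <= eta.
Proof.
move=> mf ig fg; have mg : measurable_fun setT g.
  by apply/measurable_EFinP; exact: measurable_int ig.
pose h t := f t - g t.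
have ih : haar.-integrable setT (EFin \o h).
  by apply: (@haar2_integrable _ _ eta) => //; exact: measurable_funB.
have ic : haar.-integrable setT (EFin \o (fun=> eta : R)).
  by apply: (@haar2_integrable _ _ `|eta|) => //.
have icN : haar.-integrable setT (EFin \o (fun=> - eta : R)).
  by apply: (@haar2_integrable _ _ `|- eta|) => //.
have c (k : R) : Rintegral haar setT (fun=> k) = k.
  have E := Rintegral_cst haar measurableT k.
  by rewrite [LHS]E [X in fine X]haar2_setT mulr1.
have fE : f = fun t => h t + g t by apply/funext => t; rewrite /h subrK.
have fi : haar.-integrable setT (EFin \o f).
  by have := integrableD measurableT ih ig; rewrite fE.
split => //.
have E := RintegralD measurableT ih ig.
have hl : - eta <= Rintegral haar setT h.
  rewrite -[leLHS]c; have F := le_Rintegral measurableT icN ih; apply: F => t _.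
  by have := fg t; rewrite ler_norml => /andP[].
have hu : Rintegral haar setT h <= eta.
  rewrite -[leRHS]c; have F := le_Rintegral measurableT ih ic; apply: F => t _.
  by have := fg t; rewrite ler_norml => /andP[].
by rewrite {1}fE [X in X - _]E addrK ler_norml; apply/andP; split.
Qed.

(* The mean of [gen_main], divided by [e ^ 2], when [Re (B ^ 2)] has mean [s];
   with [r0 = 1] and [r1 = r] it is the second-order coefficient of the
   logarithm of the [L^r] (quasi-)norm. *)
Definition gen_mean (s x y kap r0 r1 : R) : R :=
  r0 * (2 * kap * (1 - s) - 2 * x * y - s * (x ^+ 2 + y ^+ 2)) +
  r1 * ((x + y) ^+ 2 * (1 + s) / 2).

Lemma osc1_sqr (t : R * R) : osc 1 t ^+ 2 = 2 + osc 2 t.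
Proof.
rewrite /osc; set X := 2 * pi * (1%:R * _).
have -> : 2 * pi * (2%:R * (t.1 - t.2)) = X *+ 2 by rewrite /X -mulr_natr; ring.
by rewrite cos_mulr2n -mulr_natr; ring.
Qed.

Lemma osc_le2 (k : nat) (t : R * R) : `|osc k t| <= 2.
Proof.
by rewrite /osc normrM ger0_norm// ler_piMr// ler_norml cos_geN1 cos_le1.
Qed.

Lemma wevalX (P : {poly R}) (n : nat) (t : R * R) : weval (P ^+ n) t = weval P t ^+ n.
Proof. by rewrite /weval rmorphXn/= horner_exp. Qed.

Lemma weval1 (t : R * R) : weval (1 : {poly R}) t = 1.
Proof. by rewrite /weval rmorph1 hornerC. Qed.

(** Since [u ^ 2 = 2 + osc 2], [gen_main] is the real part of a combination of polynomials in [w],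
    with or without a factor [osc k]. Terms with that factor have mean 0; the constant coefficients
    of [1] and [P ^ 2] remain. *)
Lemma gen_main_mean (a x y kap z r0 r1 e : R) (P : {poly R}) : P`_0 = - a ->
  haar.-integrable setT
    (EFin \o (fun t => gen_main x y kap z r0 r1 e (osc 1 t) (weval P t))) /\
  Rintegral haar setT (fun t => gen_main x y kap z r0 r1 e (osc 1 t) (weval P t)) =
  e ^+ 2 * gen_mean (a ^+ 2) x y kap r0 r1.
Proof.
move=> Pa.
have PP : (P ^+ 2)`_0 = a ^+ 2 by rewrite -horner_coef0 horner_exp horner_coef0 Pa sqrrN.
have P1 : (1 : {poly R})`_0 = 1 by rewrite coef1.
(* [c2] and [c4] multiply 1 and [Re (B ^ 2)]; they come from the 2 in [u ^ 2 = 2 + osc 2], so their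
   halves go with [osc 2]. *)
pose c2 := e ^+ 2 * (r0 * (2 * kap - 2 * x * y) + r1 * ((x + y) ^+ 2 / 2)).
pose c4 := e ^+ 2 * (r0 * (- 2 * kap - (x ^+ 2 + y ^+ 2)) + r1 * ((x + y) ^+ 2 / 2)).
have D1 := riesz_dataZ (r0 * e * (x + y)) (riesz_data_osc (k := 1) P isT).
have D2 := riesz_dataZ c2 (riesz_data_weval 1).
have D3 := riesz_dataZ (c2 / 2) (riesz_data_osc (k := 2) 1 isT).
have D4 := riesz_dataZ c4 (riesz_data_weval (P ^+ 2)).
have D5 := riesz_dataZ (c4 / 2) (riesz_data_osc (k := 2) (P ^+ 2) isT).
have D6 := riesz_dataZ (- (e ^+ 2 * r0 * kap * z)) (riesz_data_osc (k := 2) P isT).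
have D := riesz_dataD D1 (riesz_dataD D2 (riesz_dataD D3 (riesz_dataD D4 (riesz_dataD D5 D6)))).
have ReD (u v : R[i]) : complex.Re (u + v) = complex.Re u + complex.Re v by case: u; case: v.
have HE : (fun t => gen_main x y kap z r0 r1 e (osc 1 t) (weval P t)) =
   (fun t => complex.Re ((r0 * e * (x + y))%:C * ((osc 1 t)%:C * weval P t) +
     (c2%:C * weval 1 t + ((c2 / 2)%:C * ((osc 2 t)%:C * weval 1 t) +
     (c4%:C * weval (P ^+ 2) t + ((c4 / 2)%:C * ((osc 2 t)%:C * weval (P ^+ 2) t) +
     (- (e ^+ 2 * r0 * kap * z))%:C * ((osc 2 t)%:C * weval P t))))))).
  apply/funext => t; rewrite !ReD !Re_realM !wevalX !weval1 /=.
  rewrite /gen_main /log_main /second_order osc1_sqr /c2 /c4.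
  set v := osc 2 t; set u := osc 1 t; set b := complex.Re (weval P t).
  set rho := complex.Re (weval P t ^+ 2).
  by field.
rewrite HE; split; first exact: integrable_Re_data D.
have E := Rintegral_Re_data D; rewrite [LHS]E PP P1 /c2 /c4 /gen_mean.
by field.
Qed.

Lemma ln_1p_near (w : R) : `|w| <= 2^-1 -> `|ln (1 + w) - w| <= 2 * w ^+ 2.
Proof.
move=> w2; have := ln_taylor3 w2.
have w3 : 2 * `|w| ^+ 3 <= w ^+ 2.
  rewrite exprS -normrX (ger0_norm (sqr_ge0 w)) mulrA ler_piMl ?sqr_ge0//; lra.
have := sqr_ge0 w.
by rewrite !ler_norml => w0 /andP[h1 h2]; apply/andP; split; lra.
Qed.

(** The first-order term has mean 0, so the logarithm of the norm starts at [e ^ 2]. For [r = 0] the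
    expanded logarithm is integrated directly; for [r > 0] the [r]-th power is integrated and the
    logarithm taken afterwards. *)
Lemma Hnorm_expansion (a x y kap z r : R) : 0 <= r -> exists C e0 : R,
  [/\ 0 < e0, e0 <= 1 & forall (e : R) (P : {poly R}) (F : R * R -> R[i]),
    0 < e <= e0 -> P`_0 = - a -> (forall t, `|nrm2 (weval P t) - 1| <= e ^+ 3) ->
    (forall t, F t = perturbed x y kap z e (osc 1 t) (weval P t)) ->
    measurable_fun setT (fun t => complex.Re (F t)) ->
    measurable_fun setT (fun t => complex.Im (F t)) ->
    exists l, Hnorm r F = (expR l)%:E /\
      `|l - e ^+ 2 * gen_mean (a ^+ 2) x y kap 1 r| <= C * e ^+ 3].
Proof.
move=> r0.
have [C1 [e1 [e10 e11 H1]]] := log_expansion x y kap z.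
have mF (F : R * R -> R[i]) : measurable_fun setT (fun t => complex.Re (F t)) ->
    measurable_fun setT (fun t => complex.Im (F t)) ->
    measurable_fun setT (fun t => cabs (F t)).
  move=> mR mI; apply: (@measurableT_comp _ _ _ _ _ _ (@Num.sqrt R)).
    by apply: continuous_measurable_fun; exact: sqrt_continuous.
  by apply: measurable_funD; apply: measurable_funX.
have [r00|rn0] := eqVneq r 0.
  exists C1, e1; split => // e P F ee Pa hP FE mR mI.
  have [im mean] := gen_main_mean x y kap z 1 0 e Pa.
  have near t : `|ln (cabs (F t)) - gen_main x y kap z 1 0 e (osc 1 t) (weval P t)| <= C1 * e ^+ 3.
    have [_] := H1 e _ _ ee (hP t) (osc_le2 1 t).
    by rewrite /gen_main mul1r !mul0r mulr0 addr0 FE.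
  have ml : measurable_fun setT (fun t => ln (cabs (F t))).
    by apply: (measurableT_comp (@measurable_ln R)); exact: mF.
  have [il hl] := Rintegral_near ml im near.
  exists (Rintegral haar setT (fun t => ln (cabs (F t)))); split; last first.
    by move: hl; rewrite mean r00.
  rewrite /Hnorm r00 eqxx.
  (* [F] has no zeros for such [e], so the value [-oo] of [elog] does not occur. *)
  have -> : (fun t => elog (cabs (F t))) = EFin \o (fun t => ln (cabs (F t))).
    apply/funext => t /=; rewrite /elog gt_eqF//.
    by have [+ _] := H1 e _ _ ee (hP t) (osc_le2 1 t); rewrite FE.
  have := @fineK _ (\int[haar]_t ((fun t => ln (cabs (F t))) t)%:E)%E.
  move=> /(_ (integrable_fin_num measurableT il)) <-.
  by [].
have rp : 0 < r by rewrite lt_def rn0.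
have [C2 [e2 [e20 e21 H2]]] := pow_expansion x y kap z r.
pose m := gen_mean (a ^+ 2) x y kap 1 r.
pose K := r * `|m| + `|C2| + 1.
have K0 : 0 < K by rewrite /K ltr_wpDl ?addr_ge0// mulr_ge0.
(* Ensures [|w| <= K e ^ 2 <= 1 / 2], so that [ln (1 + w)] can be expanded. *)
pose e3 := (2 * K)^-1.
have e30 : 0 < e3 by rewrite invr_gt0 mulr_gt0.
exists ((`|C2| + 2 * K ^+ 2) / r), (Num.min (Num.min e1 e2) e3).
split; [by rewrite !lt_min e10 e20|by rewrite !ge_min e11|].
move=> e P F /andP[e0]; rewrite !le_min => /andP[/andP[ee1 ee2] ee3] Pa hP FE mR mI.
have ep1 : e <= 1 by exact: le_trans e11.
have [im mean] := gen_main_mean x y kap z r (r ^+ 2) e Pa.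
have pos t : 0 < cabs (F t).
  by have [|+ _] := H1 e _ _ _ (hP t) (osc_le2 1 t); rewrite ?e0 ?ee1// FE.
have i1 : haar.-integrable setT (EFin \o (fun=> 1 : R)).
  by apply: (@haar2_integrable _ _ `|1|) => //.
pose g t := 1 + gen_main x y kap z r (r ^+ 2) e (osc 1 t) (weval P t).
have ig : haar.-integrable setT (EFin \o g) by have := integrableD measurableT i1 im.
(* [gen_mean] is linear in [(r0, r1)], so [r] splits off [(r, r ^ 2)]; it cancels against the final
   [r]-th root. *)
have gE : Rintegral haar setT g = 1 + e ^+ 2 * (r * m).
  have E := RintegralD measurableT i1 im; rewrite [LHS]E; congr (_ + _).
    have E1 := Rintegral_cst haar measurableT (1 : R).
    by rewrite [LHS]E1 [X in fine X]haar2_setT mulr1.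
  by rewrite [LHS]mean /m /gen_mean; ring.
have near t : `|cabs (F t) `^ r - g t| <= C2 * e ^+ 3.
  by have := H2 e _ _ _ (hP t) (osc_le2 1 t); rewrite e0 ee2 FE => /(_ isT).
have mp : measurable_fun setT (fun t => cabs (F t) `^ r).
  by apply: (measurableT_comp (measurable_powR r)); exact: mF.
have [ip hp] := Rintegral_near mp ig near.
set I := Rintegral haar setT (fun t => cabs (F t) `^ r) in hp *.
pose w := I - 1.
have e3p : 0 < e ^+ 3 by rewrite exprn_gt0.
have hw : `|w - e ^+ 2 * (r * m)| <= `|C2| * e ^+ 3.
  move: hp; rewrite gE /w opprD addrA => /le_trans; apply.
  by rewrite ler_wpM2r ?(ltW e3p)// ler_norm.
have wK : `|w| <= K * e ^+ 2.
  rewrite -[w](subrK (e ^+ 2 * (r * m))) (le_trans (ler_normD _ _))//.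
  apply: (@le_trans _ _ (`|C2| * e ^+ 2 + e ^+ 2 * (r * `|m|))).
    apply: lerD.
      apply: (le_trans hw); rewrite ler_wpM2l// exprSr ler_piMr ?sqr_ge0//.
    by rewrite normrM (ger0_norm (sqr_ge0 e)) normrM (gtr0_norm rp).
  rewrite /K; have := sqr_ge0 e; set E := e ^+ 2; lra.
have w2 : `|w| <= 2^-1.
  apply: (le_trans wK); apply: (@le_trans _ _ (K * e3)).
    rewrite ler_wpM2l ?(ltW K0)// (le_trans _ ee3)// expr2 ler_piMl ?(ltW e0)//.
  by rewrite /e3 invfM mulrCA mulfV ?mulr1// gt_eqF.
have I0 : 0 < I by move: w2; rewrite ler_norml /w => /andP[h _]; lra.
have lw := ln_1p_near w2.
exists (ln I / r); split; last first.
  have -> : ln I / r - e ^+ 2 * gen_mean (a ^+ 2) x y kap 1 r =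
      ((ln (1 + w) - w) + (w - e ^+ 2 * (r * m))) / r.
    have -> : 1 + w = I by rewrite /w; ring.
    by rewrite -/m; field.
  rewrite normrM normfV (gtr0_norm rp) [leRHS]mulrAC ler_wpM2r ?invr_ge0//.
  rewrite (le_trans (ler_normD _ _))// [leRHS]mulrDl addrC lerD//.
  rewrite (le_trans lw)// -mulrA ler_wpM2l//.
  rewrite -real_normK ?num_real// (@le_trans _ _ ((K * e ^+ 2) ^+ 2))//.
    by rewrite lerXn2r// nnegrE mulr_ge0 ?sqr_ge0// ltW.
  rewrite exprMn ler_wpM2l ?sqr_ge0// -exprM (exprSr e 3) ler_piMr//; exact: ltW.
rewrite /Hnorm (negbTE rn0) unlock /=.
have -> : (fun t => `|(cabs (F t))%:E| `^ r)%E = EFin \o (fun t => cabs (F t) `^ r).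
  by apply/funext => t /=; rewrite ger0_norm// ltW.
have := @fineK _ (\int[haar]_t ((fun t => cabs (F t) `^ r) t)%:E)%E.
move=> /(_ (integrable_fin_num measurableT ip)) <-.
by rewrite -[fine _]/I /= /powR gt_eqF// mulrC.
Qed.

End NormExpansion.

(** * Necessary conditions for admissibility *)

Section Necessity.
Variable R : realType.
Local Notation haar := (@haar2 R).

(** [z] is 0 because nothing has been projected away yet; [y] and [kap] stay free for
    optimization. *)
Definition test_fun (y kap e : R) (P : {poly R}) (t : R * R) : R[i] :=
  perturbed 1 y kap 0 e (osc 1 t) (weval P t).

(** The projection subtracts from [P ^ 2 + y] its constant coefficient [a ^ 2 + y], which turns [y]
    into [- a ^ 2]; the [osc 2] part of [u ^ 2 (P - P ^ 3)] loses [a ^ 3 - a]. As [y] drops out, it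
    can be chosen to make the norm of the test function small. *)
Lemma test_fun_projection (a y kap e : R) (P : {poly R}) : P`_0 = - a ->
  exists c, riesz_data (test_fun y kap e P)
    (fun t => perturbed 1 (- a ^+ 2) kap (a ^+ 3 - a) e (osc 1 t) (weval P t)) c.
Proof.
move=> Pa.
have PX n : (P ^+ n)`_0 = (- a) ^+ n by rewrite -horner_coef0 horner_exp horner_coef0 Pa.
have D0 := riesz_data_weval P.
have D1 := riesz_dataZ e (riesz_data_osc (k := 1) (P ^+ 2 + y%:P) isT).
have D2 := riesz_dataZ (2 * e ^+ 2 * kap) (riesz_data_weval (P - P ^+ 3)).
have D3 := riesz_dataZ (e ^+ 2 * kap) (riesz_data_osc (k := 2) (P - P ^+ 3) isT).
have D := riesz_dataD D0 (riesz_dataD D1 (riesz_dataD D2 D3)).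
have wD Q Q' t : weval (Q + Q') t = weval Q t + weval Q' t :> R[i].
  by rewrite /weval rmorphD hornerD.
have wN Q t : weval (- Q) t = - weval Q t :> R[i].
  by rewrite /weval rmorphN hornerN.
have wC (k : R) t : weval k%:P t = k%:C by rewrite /weval map_polyC hornerC.
have cM (u v : R) : (u * v)%:C = u%:C * v%:C by rewrite rmorphM.
have cD (u v : R) : (u + v)%:C = u%:C + v%:C by rewrite rmorphD.
have cN (u : R) : (- u)%:C = - u%:C by rewrite rmorphN.
have c1 : (1 : R)%:C = 1 by rewrite rmorph1.
have c2 : (2 : R)%:C = 2 by rewrite rmorph_nat.
have c0 : (0 : R)%:C = 0 by rewrite rmorph0.
eexists; apply: (riesz_data_eq D) => [t|t|]; last by [].
- rewrite /test_fun /perturbed osc1_sqr !(wD, wN, wC, wevalX).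
  by rewrite !(cM, cD, cN, c0, c1, c2); ring.
- rewrite /perturbed osc1_sqr !(wD, wN, wC, wevalX) !(coefD, coefN, coefC, PX, Pa)/=.
  have -> : (- a) ^+ 2 = a ^+ 2 by rewrite sqrrN.
  have -> : - a - (- a) ^+ 3 = a ^+ 3 - a by ring.
  by rewrite !(cM, cD, cN, c0, c1, c2); ring.
Qed.

(** Dividing the logarithms of both norms by [e ^ 2] for small [e] compares the second-order
    coefficients; [beta] is any such bound for the test function. *)
Lemma admissible_gen_mean (q : \bar R) (p a y kap beta C1 e1 : R) :
  0 < a < 1 -> admissible q p -> 0 < e1 ->
  (forall (e : R) (P : {poly R}), 0 < e <= e1 -> P`_0 = - a ->
    (forall t, `|nrm2 (weval P t) - 1| <= e ^+ 3) ->
    measurable_fun setT (fun t => complex.Re (test_fun y kap e P t)) ->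
    measurable_fun setT (fun t => complex.Im (test_fun y kap e P t)) ->
    (Lqnorm q (test_fun y kap e P) <= (expR (e ^+ 2 * beta + C1 * e ^+ 3))%:E)%E) ->
  gen_mean (a ^+ 2) 1 (- a ^+ 2) kap 1 p <= beta.
Proof.
move=> a01 [p0 adm] e10 H1.
have [C2 [e2 [e20 e21 H2]]] :=
  @Hnorm_expansion R a 1 (- a ^+ 2) kap (a ^+ 3 - a) p p0.
set al := gen_mean _ _ _ _ _ _ in H2 *.
rewrite leNgt; apply/negP => lt_ba.
pose k := `|C1| + `|C2| + 1.
have k0 : 0 < k by rewrite /k ltr_wpDl ?addr_ge0.
have d0 : 0 < (al - beta) / k / 2 by rewrite !divr_gt0// subr_gt0.
(* With this [e] the third-order errors stay below half of the assumed gap [al - beta]. *)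
pose e := Num.min (Num.min e1 e2) ((al - beta) / k / 2).
have e0 : 0 < e by rewrite !lt_min e10 e20.
have ee1 : 0 < e <= e1 by rewrite e0 /e !ge_min lexx.
have ee2 : 0 < e <= e2 by rewrite e0 /e !ge_min lexx orbT.
have ed : e * k <= (al - beta) / 2.
  have : e <= (al - beta) / k / 2 by rewrite /e ge_min lexx orbT.
  by rewrite mulrAC ler_pdivlMr.
have e3 : 0 < e ^+ 3 by rewrite exprn_gt0.
(* The truncation degree depends on [e], since the modulus must be accurate to order [e ^ 3]. *)
have [P [Pa hP]] := Blaschke_approx a01 e3.
have [c D] := test_fun_projection y kap e Pa.
have [c' D'] := riesz_data_projection D.
have mR := measurable_Re_data D.
have mI := measurable_Im_data D.
have [l [lE hl]] := H2 e P _ ee2 Pa hP (fun=> erefl)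
  (measurable_Re_data D') (measurable_Im_data D').
have hq := H1 e P ee1 Pa hP mR mI.
have psiq : inLq q (test_fun y kap e P).
  split; [exact: measurable_funTS|exact: measurable_funTS|].
  by apply: (le_lt_trans hq); rewrite ltry.
have := le_trans (adm _ psiq) hq.
rewrite (riesz_data_riesz D) lE lee_fin ler_expR => lb.
have e2p : 0 < e ^+ 2 by rewrite exprn_gt0.
have h1 : e ^+ 2 * (al - beta) <= e ^+ 2 * (e * k).
  have cC2 : C2 * e ^+ 3 <= `|C2| * e ^+ 3 by rewrite ler_wpM2r ?ler_norm// ltW.
  have cC1 : C1 * e ^+ 3 <= `|C1| * e ^+ 3 by rewrite ler_wpM2r ?ler_norm// ltW.
  have -> : e ^+ 2 * (e * k) = `|C1| * e ^+ 3 + `|C2| * e ^+ 3 + e ^+ 3 by rewrite /k; ring.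
  by move: hl; rewrite ler_norml => /andP[hl _]; lra.
by rewrite ler_pM2l// in h1; lra.
Qed.

Lemma affine_sqr_limit (A B : R) :
  (forall a, 0 < a < 1 -> A + B * a ^+ 2 <= 0) -> A + B <= 0.
Proof.
move=> H; rewrite leNgt; apply/negP => d0.
pose d := A + B; pose k := 4 * (`|B| + 1).
have k0 : 0 < k by rewrite /k mulr_gt0// ltr_wpDl.
have dk : 0 < d + k by rewrite addr_gt0.
(* At [a = 1 - t] the expression drops below [d] by at most [t k / 2 <= d / 2], so it is still
   positive. *)
pose t := d / (d + k).
have t0 : 0 < t by rewrite divr_gt0.
have t1 : t < 1 by rewrite ltr_pdivrMr// mul1r ltrDl.
have tk : t * k <= d.
  have E : t * (d + k) = d by rewrite /t divfK// gt_eqF.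
  by have td : 0 < t * d := mulr_gt0 t0 d0; lra.
have ha : 0 < 1 - t < 1 by apply/andP; split; lra.
have := H _ ha.
have -> : A + B * (1 - t) ^+ 2 = d - B * (2 * t - t ^+ 2) by rewrite /d; ring.
have BB : B * (2 * t - t ^+ 2) <= `|B| * (2 * t).
  have h : 0 <= 2 * t - t ^+ 2 by rewrite expr2; nra.
  apply: (@le_trans _ _ (`|B| * (2 * t - t ^+ 2))).
    by rewrite ler_wpM2r// ler_norm.
  by rewrite ler_wpM2l// lerBlDr lerDl sqr_ge0.
have tB : `|B| * (2 * t) <= t * k / 2.
  have Bt : 0 <= `|B| * t by rewrite mulr_ge0// ltW.
  by rewrite /k; lra.
by rewrite -/d in d0; lra.
Qed.

Lemma admissible_fin (q p : R) : 1 <= q -> admissible q%:E p -> p * (q - 1) <= 3 * q - 4.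
Proof.
move=> q1 adm.
(* The left side is twice [p (q - 1) - (3 q - 4)], written as the value at [a = 1] of an affine
   function of [a ^ 2]. *)
suff H : (p * q - 4 * (q - 1)) + (p * (q - 2) - 2 * (q - 2)) <= 0 by lra.
apply: affine_sqr_limit => a a01; set s := a ^+ 2.
have q0 : 0 <= q by lra.
have [s0 s1] : 0 < s /\ s < 1.
  by case/andP: a01 => a0 a1; rewrite /s exprn_gt0// exprn_ilt1// ltW.
pose D := q + (q - 2) * s.
have D0 : 0 < D by rewrite /D; nra.
(* the minimizer of [gen_mean s 1 y 0 1 q] *)
pose y := - (q - 2 + q * s) / D.
have [C1 [e1 [e10 _ H1]]] := @Hnorm_expansion R a 1 y 0 0 q q0.
have := @admissible_gen_mean q%:E p a y 0 (gen_mean s 1 y 0 1 q) C1 e1 a01 adm e10.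
move=> /(_ _)/wrap[|].
  move=> e P ee Pa hP mR mI.
  have [l [lE hl]] := H1 e P _ ee Pa hP (fun=> erefl) mR mI.
  have qn0 : q != 0 by rewrite gt_eqF//; lra.
  move: lE; rewrite /Hnorm (negbTE qn0) /Lqnorm => ->.
  rewrite lee_fin ler_expR; move: hl; rewrite ler_norml => /andP[_]; rewrite -/s; lra.
rewrite -/s => h.
have bE : gen_mean s 1 y 0 1 q = 2 * (q - 1) * (1 - s ^+ 2) / D.
  by rewrite /gen_mean /y /D; field; rewrite -/D gt_eqF.
have aE : gen_mean s 1 (- s) 0 1 p = (1 - s ^+ 2) / 2 * (p - (p - 2) * s).
  by rewrite /gen_mean; field.
(* Both coefficients carry the factor [1 - s ^ 2], which vanishes at [a = 1] and must be cancelled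
   before the limit. *)
have ss : 0 < 1 - s ^+ 2 by rewrite subr_gt0 exprn_ilt1// ltW.
move: h; rewrite bE aE ler_pdivlMr// => h.
have h1 : (p - (p - 2) * s) * D <= 4 * (q - 1).
  rewrite -(ler_pM2l ss); have -> : (1 - s ^+ 2) * ((p - (p - 2) * s) * D) =
   2 * ((1 - s ^+ 2) / 2 * (p - (p - 2) * s) * D) by field.
  by lra.
(* The two sides of [h1] still agree at [s = 1], so another factor [1 - s] splits off. *)
have s1' : 0 < 1 - s by lra.
rewrite -(ler_pM2l s1') mulr0.
have -> : (1 - s) * (p * q - 4 * (q - 1) + (p * (q - 2) - 2 * (q - 2)) * s) =
  (p - (p - 2) * s) * D - 4 * (q - 1) by rewrite /D; ring.
by lra.
Qed.

(** For [y = kap = -1] the first-order term vanishes with [1 + y], and the second-order term is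
    [(kap + 1) u ^ 2 (1 - Re (B ^ 2)) = 0]. Both vanish pointwise, which controls the supremum norm
    with [beta = 0]. *)
Lemma admissible_infty (p : R) : admissible +oo%E p -> p <= 3.
Proof.
move=> adm.
suff H : (p - 4) + (p - 2) <= 0 by lra.
apply: affine_sqr_limit => a a01; set s := a ^+ 2.
have [s0 s1] : 0 < s /\ s < 1.
  by case/andP: a01 => a0 a1; rewrite /s exprn_gt0// exprn_ilt1// ltW.
have [C1 [e1 [e10 _ H1]]] := @log_expansion R 1 (-1) (-1) 0.
have := @admissible_gen_mean +oo%E p a (-1) (-1) 0 C1 e1 a01 adm e10.
move=> /(_ _)/wrap[|].
  move=> e P ee Pa hP mR mI.
  rewrite /Lqnorm unlock /=; case: ifP => _; last by rewrite lee_fin expR_ge0.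
  apply/ess_supP; apply: aeW => t /=.
  rewrite lee_fin ger0_norm ?sqrtr_ge0// mulr0 add0r.
  have [pos] := H1 e _ _ ee (hP t) (osc_le2 1 t).
  have -> : log_main 1 (-1) (-1) 0 e (osc 1 t) (weval P t) = 0.
    by rewrite /log_main /second_order; field.
  rewrite subr0 ler_norml => /andP[_ h].
  by rewrite -[leLHS]lnK ?posrE// ler_expR.
rewrite -/s => h.
have s1' : 0 < 1 - s by lra.
(* The coefficient for the projection is [(1 - s) ^ 2 / 2] times the affine function of [s] to be
   bounded. *)
have ss : 0 < (1 - s) ^+ 2 by rewrite exprn_gt0.
rewrite -(ler_pM2l ss) mulr0.
move: h; rewrite /gen_mean.
by set X := (X in X <= 0); set Y := (Y in _ -> Y <= 0); have -> : Y = 2 * X; [rewrite /X /Y; field|lra].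
Qed.

End Necessity.

(* The bound on the critical exponent *)
Local Close Scope complex_scope.
Unset Implicit Arguments.

Theorem theorem3 (R : realType) (q : \bar R) :
  (1%:E <= q)%E ->
  (((4 / 3)%:E <= q)%E -> (pfrak2 q <= afrak2 q)%E) /\
  ((q < (4 / 3)%:E)%E -> pfrak2 q = (-1)%E).
Proof.
move=> q1; split => [q43|q43]; rewrite /pfrak2; case: asboolP => [ex|_].
- apply: ub_ereal_sup => _ [p adm <-].
  case: q q1 q43 ex adm => [r| |] //; rewrite ?lee_fin => r1 r43 _ adm; last first.
    exact: admissible_infty adm.
  have rr : 0 < r - 1 by lra.
  have := admissible_fin r1 adm.
  change (p * (r - 1) <= 3 * r - 4 -> (p%:E <= (4 - r / (r - 1))%:E)%E); rewrite lee_fin.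
  have -> : 4 - r / (r - 1) = (3 * r - 4) / (r - 1) by field; rewrite gt_eqF.
  by rewrite ler_pdivlMr.
(* Without admissible exponents the value is -1, which lies below [afrak2 q] because the latter is
   nonnegative for [q >= 4 / 3]. *)
- case: q q1 q43 => [r| |] //; last by move=> *; change ((-1 : R) <= 3); lra.
  rewrite !lee_fin => r1 r43.
  have rr : 0 < r - 1 by lra.
  change ((-1 : R) <= 4 - r / (r - 1)).
  have -> : 4 - r / (r - 1) = (3 * r - 4) / (r - 1) by field; rewrite gt_eqF.
  by apply: (@le_trans _ _ 0) => //; apply: divr_ge0; lra.
(* For [q < 4 / 3] the bound [p (q - 1) <= 3 q - 4 < 0] contradicts [p >= 0]. *)
- exfalso; case: ex => p adm; case: q q1 q43 adm => [r| |] //.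
  rewrite lee_fin lte_fin => r1 r43 adm.
  have := admissible_fin r1 adm; case: adm => p0 _.
  have : 0 <= p * (r - 1) by rewrite mulr_ge0// subr_ge0.
  by lra.
- by [].
Qed.
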